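(* Let $m$ be a positive integer and let $\lambda\in\mathbb{T}$. A function $f\in H^2$ belongs to the local Dirichlet space $\mathcal{D}^m_\lambda$ of order $m$ at $\lambda$ if and only if $$\int_{\mathbb{D}}\left|\frac{f^{(m)}(z)}{(z-\lambda)^m}\right|^2(1-|z|^2)^{2m-1}\,dA(z)<\infty.$$
   Context: $\mathbb{D}$ is the open unit disc in $\mathbb{C}$, $\mathbb{T}=\partial\mathbb{D}$, $H^2$ is the Hardy space of $\mathbb{D}$, $\mathrm{Hol}(\mathbb{D})$ is the set of holomorphic functions on $\mathbb{D}$, and $A$ is the normalized area measure on $\mathbb{D}$. For $\lambda\in\mathbb{T}$ and a positive integer $m$, the local Dirichlet space of order $m$ at $\lambda$ is $$\mathcal{D}^m_{\lambda}=\{f\in\mathrm{Hol}(\mathbb{D}):\ f=p+(z-\lambda)^m g,\ p \text{ a polynomial of degree } <m,\ g\in H^2\}.$$ *)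

(* Defs.v *)
From mathcomp Require Import all_boot all_order all_algebra.
From mathcomp Require Import complex.
From mathcomp Require Import all_classical all_reals all_analysis.
Import Order.TTheory GRing.Theory Num.Theory.
Import numFieldNormedType.Exports.

Set Implicit Arguments.
Unset Strict Implicit.
Unset Printing Implicit Defensive.

Local Open Scope classical_set_scope.
Local Open Scope complex_scope.
Local Open Scope ring_scope.

Local Notation normc := ComplexField.Normc.normc.

Definition disc (R : realType) : set R[i] := [set z | `|z| < 1].

Definition torus (R : realType) : set R[i] := [set z | `|z| = 1].

(* Functions on the disc are represented by total functions on [R[i]]; only
   their values on the open set [disc] are ever used.  The regular module
   [R[i]^o] carries the normed-module structure of R[i] over itself, so that
   derivatives are complex derivatives. *)
Definition holomorphic_disc (R : realType) (f : R[i]^o -> R[i]^o) : Prop :=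
  forall z : R[i]^o, disc z -> derivable f z 1.

(* Hardy space: holomorphic functions on the disc whose Taylor coefficients at
   the origin are square-summable. *)
Definition hardy2 (R : realType) (f : R[i]^o -> R[i]^o) : Prop :=
  holomorphic_disc f /\
  exists a : nat -> R[i]^o,
    (forall z : R[i]^o, disc z ->
       series (fun n => a n * z ^+ n : R[i]^o) @ \oo --> f z) /\
    (\sum_(0 <= n <oo) (normc (a n) ^+ 2)%:E < +oo)%E.

Definition local_dirichlet (R : realType) (m : nat) (lambda : R[i])
    (f : R[i]^o -> R[i]^o) : Prop :=
  holomorphic_disc f /\
  exists (p : {poly R[i]}) (g : R[i]^o -> R[i]^o),
    [/\ (size p <= m)%N, hardy2 g &
        forall z : R[i]^o, disc z -> f z = p.[z] + (z - lambda) ^+ m * g z].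

Lemma invpi_ge0 (R : realType) : 0 <= (pi : R)^-1.
Proof. by rewrite invr_ge0 pi_ge0. Qed.

(* The factor 1/pi gives the unit disc total mass one. *)
Definition area (R : realType) :
    {measure set (measurableTypeR R * measurableTypeR R) -> \bar R} :=
  mscale (NngNum (invpi_ge0 R)) (lebesgue_measure \x lebesgue_measure)%E.

Definition dirichlet_integral (R : realType) (m : nat) (lambda : R[i])
    (f : R[i]^o -> R[i]^o) : \bar R :=
  (\int[area R]_(w in [set w | disc (w.1 +i* w.2)])
     (let z : R[i]^o := w.1 +i* w.2 in
      (normc (f^`(m)%classic z / (z - lambda) ^+ m) ^+ 2 *
       (1 - normc z ^+ 2) ^+ (2 * m - 1))%:E))%E.

(* Main.v *)
Require Import Defs.
From mathcomp Require Import all_boot all_order all_algebra.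
From mathcomp Require Import complex.
From mathcomp Require Import all_classical all_reals all_analysis.
From mathcomp Require Import measurable_realfun.
From mathcomp Require Import ring lra zify.
Import Order.TTheory GRing.Theory Num.Theory.
Import numFieldNormedType.Exports.

(** Write [l] for the boundary point, [D] for differentiation, [M] for
    multiplication by [z - l] and [S] for division by [z - l], all of them acting
    on sequences of Taylor coefficients.  Let W_s be the space of sequences [x]
    with sum |x_n|^2 / (n+1)^(2s) finite ([wl2 s]), so that W_0 is H^2.

    The algebra.  From D M = M D + 1 one gets D M^m = M^m E for E = D + m S
    ([twist]), and therefore D^m M^m = M^m E^m.  If f = p + (z - l)^m g with
    deg p < m, then D^m kills p, so the coefficients of f^(m) / (z - l)^m are
    E^m g.  Conversely, if these coefficients are E^m y, then f - M^m y is killed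
    by D^m, that is, it is a polynomial of degree less than m.  Hence f belongs to
    the local Dirichlet space if and only if the coefficients of
    f^(m) / (z - l)^m lie in E^m W_0.

    The inequality.  E^m maps W_0 onto W_m.  Since |l| = 1, S is summation of
    the coefficients up to unimodular factors, and Hardy's inequality
    ([l2_cesaro]) says that summation maps W_s into W_(s+1), as D obviously
    does: this is [wl2_twist].  That E maps W_s onto W_(s+1) for s < m is
    [twist_onto]: in terms of S y the equation E y = x is a recurrence of the
    first order, solved by an explicit tail sum, and tails are controlled by the
    dual Hardy inequality ([l2_tail]).

    The integral.  By orthogonality of the monomials, the integral of
    |h|^2 (1 - |z|^2)^(2m-1) over the disc is a constant times
    sum |h_n|^2 B(n+1, 2m), and B(n+1, 2m) is comparable to (n+1)^(-2m); so it is
    finite exactly when the coefficients of h are in W_m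
    ([dirichlet_integralP]).  Polar coordinates are replaced by two facts: planar
    Lebesgue measure is invariant under rotations, because a rotation is a product
    of three shears ([ge0_integral_rotate]), and its image under |z|^2 is a
    multiple of Lebesgue measure on the half-line, because of its behaviour under
    dilations ([ge0_integral_radial]).  Orthogonality then comes from averaging
    over the rotations by roots of unity, where it is the discrete Parseval
    identity ([root_parseval]); Fatou's lemma carries both inequalities from
    partial sums to power series ([integral_power_sum_le],
    [integral_power_sum_ge]). *)

Set Implicit Arguments.
Unset Strict Implicit.
Unset Printing Implicit Defensive.
Local Open Scope classical_set_scope.
Local Open Scope ring_scope.

Import ComplexField.Normc.

Local Notation mu2 R := (@lebesgue_measure R \x @lebesgue_measure R)%E.
Local Notation plane R := (measurableTypeR R * measurableTypeR R)%type.

(** * Hardy's inequality in l^2 and its dual *)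

(** Bounded partial sums rather than an infinite sum: every estimate below is
    between finite sums. *)
Definition l2 (R : realType) (u : nat -> R) : Prop :=
  exists C : R, forall N, \sum_(n < N) u n ^+ 2 <= C.

Lemma l2_dom (R : realType) (c : R) (u v : nat -> R) :
  (forall n, 0 <= u n <= c * v n) -> l2 v -> l2 u.
Proof.
move=> uv [C hC]; exists (c ^+ 2 * C) => N.
apply: (@le_trans _ _ (c ^+ 2 * \sum_(n < N) v n ^+ 2)); last first.
  by rewrite ler_wpM2l ?sqr_ge0.
rewrite mulr_sumr ler_sum // => i _.
have /andP[u0 uc] := uv i.
by rewrite -exprMn ler_pXn2r // nnegrE // (le_trans u0).
Qed.

Lemma l2D (R : realType) (u v : nat -> R) :
  l2 u -> l2 v -> l2 (fun n => u n + v n).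
Proof.
move=> [C hC] [K hK]; exists (2 * C + 2 * K) => N.
apply: (@le_trans _ _ (2 * \sum_(n < N) u n ^+ 2 + 2 * \sum_(n < N) v n ^+ 2)).
  rewrite !mulr_sumr -big_split /= ler_sum // => i _.
  have := sqr_ge0 (u i - v i); nra.
by apply: lerD; rewrite ler_pM2l.
Qed.

Lemma l2_shift (R : realType) (u : nat -> R) : l2 u <-> l2 (fun n => u n.+1).
Proof.
split=> -[C hC].
  exists C => N; apply: le_trans (hC N.+1).
  by rewrite big_ord_recl /= lerDr sqr_ge0.
exists (u 0%N ^+ 2 + C) => -[|N].
  by rewrite big_ord0 addr_ge0 ?sqr_ge0// (le_trans _ (hC 0%N))// big_ord0.
by rewrite big_ord_recl lerD2l; exact: hC.
Qed.

(** Hardy's inequality with its sharp constant 4.  With A_N the mean of the first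
    N terms, the elementary inequality
    A_(N+1)^2 + 2 (N+1) A_(N+1)^2 - 2 N A_N^2 <= 4 u_N^2 telescopes; the difference
    of its two sides is (A_(N+1) - 2 u_N)^2 + 2 N (A_(N+1) - A_N)^2. *)
Lemma l2_cesaro (R : realType) (u : nat -> R) :
  l2 u -> l2 (fun n => (\sum_(k < n.+1) u k) / n.+1%:R).
Proof.
move=> [C hC]; exists (4 * C) => N.
apply: (@le_trans _ _ (4 * \sum_(n < N) u n ^+ 2)); last by rewrite ler_pM2l.
suff H : \sum_(n < N) ((\sum_(k < n.+1) u k) / n.+1%:R) ^+ 2 +
    2 * N%:R * ((\sum_(k < N) u k) / N%:R) ^+ 2 <= 4 * \sum_(n < N) u n ^+ 2.
  by apply: le_trans H; rewrite lerDl mulr_ge0 ?sqr_ge0// mulr_ge0.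
elim: N => [|N IH]; first by rewrite !big_ord0 mulr0 mul0r addr0 mulr0.
rewrite [X in X + _ <= _]big_ord_recr [X in _ <= 4 * X]big_ord_recr /=.
set S := \sum_(k < N) u k in IH *.
rewrite [\sum_(k < N.+1) u k]big_ord_recr -/S /=.
set A' := S / N%:R in IH *; set A := (S + u N) / N.+1%:R.
have SA' : S = N%:R * A'.
  rewrite /A' /S; case: N {IH A' A S} => [|N]; first by rewrite big_ord0 !mul0r.
  by rewrite mulrC divfK.
have SA : S + u N = (N%:R + 1) * A by rewrite /A natr1 mulrC divfK.
have uE : u N = (N%:R + 1) * A - N%:R * A' by rewrite -SA -SA' addrC addKr.
have N0 : 0 <= N%:R :> R by [].
have H0 := sqr_ge0 (A - 2 * u N).
have H1 : 0 <= N%:R * (A - A') ^+ 2 by rewrite mulr_ge0 ?sqr_ge0.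
rewrite -[N.+1%:R]natr1 uE in H0 *; move: IH H0 H1.
set s1 := \sum_(n < N) _; set s2 := \sum_(n < N) _.
move: (N%:R) A A' {uE SA SA'} => n A A'; nra.
Qed.

(** The telescoping form of the dual inequality: [T] plays the role of the tail
    sums of u_n / (n+1), and the summand T_n^2 is bounded by
    4 u_n^2 + 2 (n+1) T_(n+1)^2 - 2 n T_n^2, the difference being
    (T_n - 2 u_n)^2 + 2 (n+1) (T_n - T_(n+1))^2. *)
Lemma hardy_tail (R : realType) (u T : nat -> R) :
  (forall n, n.+1%:R * (T n - T n.+1) = u n) -> forall N,
  \sum_(n < N) T n ^+ 2 <= 4 * \sum_(n < N) u n ^+ 2 + 2 * N%:R * T N ^+ 2.
Proof.
move=> hT; elim=> [|N IH]; first by rewrite !big_ord0 !mulr0 mul0r addr0.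
rewrite !big_ord_recr /=.
have N0 : 0 <= N%:R + 1 :> R by rewrite natr1.
have H0 := sqr_ge0 (T N - 2 * u N).
have H1 : 0 <= (N%:R + 1) * (T N - T N.+1) ^+ 2 by rewrite mulr_ge0 ?sqr_ge0.
have := hT N; rewrite -[N.+1%:R]natr1 => uE; rewrite -uE in H0 *; move: IH H0 H1.
set s1 := \sum_(n < N) _; set s2 := \sum_(n < N) _.
move: (N%:R) (T N) (T N.+1) {uE} => n A A'; nra.
Qed.

Definition bounded_sums (R : realType) (u : nat -> R) : Prop :=
  exists C : R, forall N, \sum_(n < N) u n <= C.

Lemma bounded_sums_cvg (R : realType) (u : nat -> R) : (forall n, 0 <= u n) ->
  bounded_sums u -> cvgn (series u).
Proof.
move=> u0 [C hC]; apply: nondecreasing_is_cvgn.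
  by apply: nondecreasing_series => n _ _; exact: u0.
by exists C => _ [n _ <-]; rewrite /series /= big_mkord.
Qed.

Lemma bounded_sums_le_lim (R : realType) (u : nat -> R) n : (forall n, 0 <= u n) ->
  bounded_sums u -> \sum_(k < n) u k <= limn (series u).
Proof.
move=> u0 su; have nd : nondecreasing_seq (series u).
  by apply: nondecreasing_series => k _ _; exact: u0.
have := nondecreasing_cvgn_le nd (bounded_sums_cvg u0 su) n.
by rewrite /series /= big_mkord.
Qed.

(** Dual Hardy inequality.  It is proved for the truncated tails, for which the
    boundary term of [hardy_tail] vanishes, uniformly in the truncation. *)
Lemma l2_tail (R : realType) (u : nat -> R) : (forall n, 0 <= u n) -> l2 u ->
  let v n := u n / n.+1%:R in
  bounded_sums v /\ l2 (fun n => limn (series v) - \sum_(k < n) v k).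
Proof.
move=> u0 [C hC] v.
have v0 n : 0 <= v n by rewrite divr_ge0.
(* truncation at N turns the boundary term of the telescoping sum into zero *)
have key M N : (M <= N)%N ->
    \sum_(n < M) (\sum_(k < N) v k - \sum_(k < n) v k) ^+ 2 <= 4 * C.
  move=> MN; pose T n := \sum_(k < N) v k - \sum_(k < n) v k.
  have hT n : n.+1%:R * (T n - T n.+1) = u n.
    rewrite /T [in X in _ - (_ - X)]big_ord_recr /=.
    rewrite (_ : _ - _ = v n); last by ring.
    by rewrite /v mulrC divfK.
  have := hardy_tail hT N; rewrite /T subrr expr0n mulr0 addr0.
  move=> /le_trans /(_ (ler_wpM2l _ (hC N))) => /(_ (ler0n _ 4)).
  apply: le_trans; rewrite -!(big_mkord xpredT (fun n => T n ^+ 2)).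
  rewrite [leRHS](big_cat_nat (n := M)) //= lerDl.
  by rewrite sumr_ge0 // => i _; rewrite sqr_ge0.
have sv : bounded_sums v.
  exists (1 + 4 * C) => -[|N].
    rewrite big_ord0 addr_ge0// mulr_ge0//.
    by have := hC 0%N; rewrite big_ord0.
  (* the first tail is the whole partial sum, so Hardy's inequality also bounds it *)
  have := key 1%N N.+1 isT; rewrite big_ord1 big_ord0 subr0.
  set s := \sum_(k < _) _ => H.
  have := sqr_ge0 (s - 1); nra.
split=> //; exists (4 * C) => M.
have /cvg_ex[l hl] := bounded_sums_cvg v0 sv.
rewrite (cvg_lim _ hl)//.
have cv : (fun N => \sum_(n < M) (\sum_(k < N) v k - \sum_(k < n) v k) ^+ 2) @ \oo
    --> \sum_(n < M) (l - \sum_(k < n) v k) ^+ 2.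
  apply: (cvg_big add_continuous) => i _.
  have h : (fun N => \sum_(k < N) v k - \sum_(k < i) v k) @ \oo --> l - \sum_(k < i) v k.
    apply: cvgB; last exact: cvg_cst.
    by under eq_cvg do rewrite -(big_mkord xpredT).
  by rewrite expr2; under eq_cvg do rewrite expr2; apply: cvgM.
rewrite -(cvg_lim _ cv)//; apply: limr_le; first by apply/cvg_ex; eexists; exact: cv.
by exists M => // N /= MN; exact: key.
Qed.

(** * Absolutely convergent complex series *)

Lemma normc_ge0 (R : realType) (z : R[i]) : 0 <= normc z.
Proof. by case: z => a b; exact: sqrtr_ge0. Qed.

Lemma normcX (R : realType) (z : R[i]) n : normc (z ^+ n) = normc z ^+ n.
Proof.
elim: n => [|n IH]; first by rewrite !expr0 normc1.
by rewrite !exprS normcM IH.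
Qed.

Lemma normc_nat (R : realType) n : normc (n%:R : R[i]) = n%:R.
Proof. by rewrite (normcMn (1 : R[i]) n) normc1. Qed.

Lemma normcB (R : realType) (x y : R[i]) : normc (x - y) <= normc x + normc y.
Proof. by rewrite -(normcN y); exact: le_normcD. Qed.

Lemma normc_sum (R : realType) (I : Type) (r : seq I) (P : pred I) (F : I -> R[i]) :
  normc (\sum_(i <- r | P i) F i) <= \sum_(i <- r | P i) normc (F i).
Proof.
elim/big_rec2: _ => [|i x y _ IH]; first by rewrite normc0.
by apply: le_trans (le_normcD _ _) _; rewrite lerD2l.
Qed.

Lemma normc_sqr (R : realType) (z : R[i]) :
  normc z ^+ 2 = complex.Re z ^+ 2 + complex.Im z ^+ 2.
Proof. by case: z => a b /=; rewrite sqr_sqrtr // addr_ge0 ?sqr_ge0. Qed.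

Lemma normRe_le (R : realType) (z : R[i]) : `|complex.Re z| <= normc z.
Proof.
case: z => a b /=; rewrite -sqrtr_sqr ler_wsqrtr //.
by rewrite lerDl sqr_ge0.
Qed.

Lemma normIm_le (R : realType) (z : R[i]) : `|complex.Im z| <= normc z.
Proof.
case: z => a b /=; rewrite -sqrtr_sqr ler_wsqrtr //.
by rewrite lerDr sqr_ge0.
Qed.

Lemma Re_sum (R : realType) (I : Type) (r : seq I) (P : pred I) (F : I -> R[i]) :
  complex.Re (\sum_(i <- r | P i) F i) = \sum_(i <- r | P i) complex.Re (F i).
Proof.
elim: r => [|i r IH]; first by rewrite !big_nil.
rewrite !big_cons; case: ifP => // _; rewrite -IH.
by case: (F i) => a b; case: (\sum_(j <- r | P j) F j).
Qed.

Lemma Im_sum (R : realType) (I : Type) (r : seq I) (P : pred I) (F : I -> R[i]) :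
  complex.Im (\sum_(i <- r | P i) F i) = \sum_(i <- r | P i) complex.Im (F i).
Proof.
elim: r => [|i r IH]; first by rewrite !big_nil.
rewrite !big_cons; case: ifP => // _; rewrite -IH.
by case: (F i) => a b; case: (\sum_(j <- r | P j) F j).
Qed.

(** Summation through real and imaginary parts, which relies on completeness of
    the real field only. *)
Definition csum (R : realType) (c : nat -> R[i]) : R[i] :=
  Complex (limn (series (fun n => complex.Re (c n))))
          (limn (series (fun n => complex.Im (c n)))).

Lemma abs_bounded_sums_cvg (R : realType) (u v : nat -> R) :
  (forall n, `|u n| <= v n) -> bounded_sums v -> cvgn (series u).
Proof.
move=> uv [C hC]; apply: normed_cvg; apply: bounded_sums_cvg => [n|].
  exact: normr_ge0.
by exists C => N; apply: le_trans (hC N); apply: ler_sum => i _; exact: uv.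
Qed.

(** The remainder of a series is estimated by any common bound of the finite
    blocks of absolute values. *)
Lemma csum_tail (R : realType) (c : nat -> R[i]) (B : R) n :
  bounded_sums (fun k => normc (c k)) ->
  (forall N, (n <= N)%N -> \sum_(n <= k < N) normc (c k) <= B) ->
  normc (csum c - \sum_(0 <= k < n) c k) <= B.
Proof.
move=> sc hB.
have B0 : 0 <= B by have := hB n (leqnn _); rewrite big_geq.
have /cvg_ex[a ha] := abs_bounded_sums_cvg (fun n => normRe_le (c n)) sc.
have /cvg_ex[b hb] := abs_bounded_sums_cvg (fun n => normIm_le (c n)) sc.
rewrite /csum (cvg_lim _ ha)// (cvg_lim _ hb)//.
rewrite -(ler_pXn2r (n := 2)) ?nnegrE ?normc_ge0// normc_sqr.
set s := \sum_(0 <= k < n) c k.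
have h : (fun N => (series (fun n => complex.Re (c n)) N - complex.Re s) ^+ 2 +
   (series (fun n => complex.Im (c n)) N - complex.Im s) ^+ 2) @ \oo -->
   (a - complex.Re s) ^+ 2 + (b - complex.Im s) ^+ 2.
  rewrite !expr2; under eq_cvg do rewrite !expr2.
  by apply: cvgD; apply: cvgM; apply: cvgB => //; exact: cvg_cst.
have -> : complex.Re (a +i* b - s)%C ^+ 2 + complex.Im (a +i* b - s)%C ^+ 2 =
   (a - complex.Re s) ^+ 2 + (b - complex.Im s) ^+ 2 by case: (s).
rewrite -(cvg_lim _ h)//; apply: limr_le; first by apply/cvg_ex; eexists; exact: h.
exists n => // N /= nN.
have -> : series (fun n => complex.Re (c n)) N - complex.Re s =
    complex.Re (\sum_(n <= k < N) c k).
  rewrite /series /s /= !Re_sum [X in X - _](big_cat_nat (n := n)) //=.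
  by rewrite addrAC subrr add0r.
have -> : series (fun n => complex.Im (c n)) N - complex.Im s =
    complex.Im (\sum_(n <= k < N) c k).
  rewrite /series /s /= !Im_sum [X in X - _](big_cat_nat (n := n)) //=.
  by rewrite addrAC subrr add0r.
rewrite -normc_sqr ler_pXn2r ?nnegrE ?normc_ge0//.
exact: le_trans (normc_sum _ _ _) (hB N nN).
Qed.

(** * Weighted coefficient spaces and the operator D + m/(z - l) *)

(** The coefficient sequences of the s-th derivatives of H^2 functions. *)
Definition wl2 (R : realType) (s : nat) (x : nat -> R[i]) : Prop :=
  l2 (fun n => normc (x n) / n.+1%:R ^+ s).

(** Coefficients of (z - l) x(z). *)
Definition mulXsub (R : realType) (l : R[i]) (x : nat -> R[i]) (n : nat) : R[i] :=
  (if n is k.+1 then x k else 0) - l * x n.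

Definition coef_deriv (R : realType) (x : nat -> R[i]) (n : nat) : R[i] :=
  n.+1%:R * x n.+1.

(** Coefficients of x(z) / (z - l), by the recursion that makes it a section of
    [mulXsub]. *)
Fixpoint divXsub (R : realType) (l : R[i]) (x : nat -> R[i]) (n : nat) : R[i] :=
  ((if n is k.+1 then divXsub l x k else 0) - x n) / l.

Lemma wl2D (R : realType) s (x y : nat -> R[i]) :
  wl2 s x -> wl2 s y -> wl2 s (x + y).
Proof.
move=> hx hy; apply: (l2_dom (c := 1)) (l2D hx hy) => n.
rewrite divr_ge0 ?normc_ge0 ?exprn_ge0//= mul1r -mulrDl ler_wpM2r//.
exact: le_normcD.
Qed.

Lemma wl2_scale (R : realType) s (a : R[i]) (x : nat -> R[i]) :
  wl2 s x -> wl2 s (a *: x).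
Proof.
move=> hx; apply: (l2_dom (c := normc a)) hx => n.
by rewrite divr_ge0 ?normc_ge0 ?exprn_ge0//= mulrA normcM.
Qed.

Lemma wl2_coef_deriv (R : realType) s (x : nat -> R[i]) :
  wl2 s x -> wl2 s.+1 (coef_deriv x).
Proof.
move=> /l2_shift hx; apply: (l2_dom (c := 2 ^+ s)) hx => n.
rewrite divr_ge0 ?normc_ge0 ?exprn_ge0//= /coef_deriv.
rewrite normcM normc_nat exprS -mulf_div divff// mul1r.
rewrite mulrCA ler_wpM2l ?normc_ge0//.
rewrite -[_ / _]invrK invf_div lef_pV2 ?posrE ?divr_gt0 ?exprn_gt0//.
rewrite ler_pdivrMr ?exprn_gt0// -exprMn lerXn2r ?nnegrE//.
by rewrite -natrM ler_nat mulnC; lia.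
Qed.

(** On the unit circle dividing by z - l is, up to unimodular factors, taking
    partial sums. *)
Lemma normc_divXsub (R : realType) (l : R[i]) (x : nat -> R[i]) n :
  normc l = 1 -> normc (divXsub l x n) <= \sum_(k < n.+1) normc (x k).
Proof.
move=> l1; elim: n => [|n IH].
  rewrite big_ord_recr big_ord0 /= !add0r.
  by rewrite normcM normcV l1 invr1 mulr1 normcN.
rewrite big_ord_recr /= normcM normcV.
rewrite l1 invr1 mulr1; apply: le_trans (normcB _ _) _.
by rewrite lerD2r.
Qed.

(** This is Hardy's inequality: the weight (n+1)^(-s) is decreasing, so it can be
    moved inside the partial sum, which leaves a Cesaro mean. *)
Lemma wl2_divXsub (R : realType) s (l : R[i]) (x : nat -> R[i]) :
  normc l = 1 -> wl2 s x -> wl2 s.+1 (divXsub l x).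
Proof.
move=> l1 /l2_cesaro hx; apply: (l2_dom (c := 1)) hx => n.
rewrite divr_ge0 ?normc_ge0 ?exprn_ge0//= mul1r exprSr invfM mulrA ler_wpM2r//.
apply: le_trans (ler_wpM2r _ (normc_divXsub x n l1)) _.
  by rewrite invr_ge0 exprn_ge0.
rewrite mulr_suml ler_sum// => i _; rewrite ler_wpM2l ?normc_ge0//.
rewrite lef_pV2 ?posrE ?exprn_gt0// lerXn2r ?nnegrE// ler_nat.
exact: ltn_ord.
Qed.

Lemma wl2_mulXsub (R : realType) s (l : R[i]) (x : nat -> R[i]) :
  wl2 s x -> wl2 s (mulXsub l x).
Proof.
move=> hx; apply/l2_shift.
apply: (l2_dom (c := 1 + normc l)) (l2D hx (iffLR (l2_shift _) hx)) => n.
rewrite divr_ge0 ?normc_ge0 ?exprn_ge0//= /mulXsub.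
have h : normc (x n) / n.+2%:R ^+ s <= normc (x n) / n.+1%:R ^+ s.
  rewrite ler_wpM2l ?normc_ge0// lef_pV2 ?posrE ?exprn_gt0//.
  by rewrite lerXn2r ?nnegrE// ler_nat.
apply: le_trans (ler_wpM2r _ (normcB _ _)) _; first by rewrite invr_ge0 exprn_ge0.
rewrite normcM mulrDl -mulrA.
have := normc_ge0 l; have : 0 <= normc (x n.+1) / n.+2%:R ^+ s.
  by rewrite divr_ge0 ?normc_ge0 ?exprn_ge0.
have : 0 <= normc (x n) / n.+1%:R ^+ s.
  by rewrite divr_ge0 ?normc_ge0 ?exprn_ge0.
move: h; nra.
Qed.

Lemma iter_mulXsubD (R : realType) (l : R[i]) k (x y : nat -> R[i]) :
  iter k (mulXsub l) (x + y) = iter k (mulXsub l) x + iter k (mulXsub l) y.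
Proof.
elim: k => //= k ->; apply/funext => -[|n]; rewrite /mulXsub !addrfctE; ring.
Qed.

Lemma iter_coef_derivD (R : realType) k (x y : nat -> R[i]) :
  iter k (@coef_deriv R) (x + y) = iter k (@coef_deriv R) x + iter k (@coef_deriv R) y.
Proof.
elim: k => //= k ->; apply/funext => n; rewrite /coef_deriv !addrfctE; ring.
Qed.

Lemma divXsubK (R : realType) (l : R[i]) (x : nat -> R[i]) : l != 0 ->
  mulXsub l (divXsub l x) = x.
Proof.
move=> l0; apply/funext => -[|n]; rewrite /mulXsub /= mulrC divfK //; ring.
Qed.

Lemma mulXsubK (R : realType) (l : R[i]) (x : nat -> R[i]) : l != 0 ->
  divXsub l (mulXsub l x) = x.
Proof.
move=> l0; apply/funext; elim => [|n /= ->]; rewrite /= /mulXsub /=.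
  by rewrite !sub0r opprK mulrC mulKf.
by rewrite opprB addrC subrK mulrC mulKf.
Qed.

Lemma coef_deriv_mulXsub (R : realType) (l : R[i]) (x : nat -> R[i]) :
  coef_deriv (mulXsub l x) = mulXsub l (coef_deriv x) + x.
Proof.
apply/funext => -[|n]; rewrite !addrfctE /coef_deriv /mulXsub -!natr1; ring.
Qed.

(** The operator [D + m / (z - l)], which is [D] conjugated by multiplication by
    (z - l)^m. *)
Definition twist (R : realType) (l : R[i]) (m : nat) (y : nat -> R[i]) :=
  coef_deriv y + m%:R *: divXsub l y.

(** Induction on [m]: each factor commuted past the derivative contributes one
    more copy of the function divided by z - l. *)
Lemma coef_deriv_iter_mulXsub (R : realType) (l : R[i]) m (y : nat -> R[i]) :
  l != 0 -> coef_deriv (iter m (mulXsub l) y) = iter m (mulXsub l) (twist l m y).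
Proof.
move=> l0; rewrite /twist; elim: m => [|m IH] /=.
  by rewrite scale0r addr0.
rewrite coef_deriv_mulXsub IH -[X in _ + iter m _ X](divXsubK y l0).
rewrite -iterSr -!iterS -iter_mulXsubD -addrA; congr (iter _ _ (_ + _)).
by rewrite -natr1 scalerDl scale1r.
Qed.

Lemma iter_coef_deriv_mulXsub (R : realType) (l : R[i]) m k (y : nat -> R[i]) :
  l != 0 -> iter k (@coef_deriv R) (iter m (mulXsub l) y) =
            iter m (mulXsub l) (iter k (twist l m) y).
Proof. by move=> l0; elim: k => //= k ->; rewrite coef_deriv_iter_mulXsub. Qed.

Lemma wl2_twist (R : realType) s (l : R[i]) m (y : nat -> R[i]) :
  normc l = 1 -> wl2 s y -> wl2 s.+1 (twist l m y).
Proof.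
move=> l1 hy; apply: wl2D; first exact: wl2_coef_deriv.
by apply: wl2_scale; exact: wl2_divXsub.
Qed.

(** The rising factorial (n+1)(n+2)...(n+m).  It solves the homogeneous recurrence
    behind [twist] and it is the denominator of the beta moments. *)
Definition rising (m n : nat) : nat := \prod_(i < m) (n.+1 + i)%N.

Lemma rising_gt0 m n : (0 < rising m n)%N.
Proof. by rewrite prodn_gt0. Qed.

Lemma risingS m n : (n.+1 * rising m n.+1 = (n.+1 + m) * rising m n)%N.
Proof.
rewrite /rising; elim: m => [|m IH]; first by rewrite !big_ord0 addn0.
rewrite !big_ord_recr /= mulnA IH.
by move: (\prod_(i < m) _)%N => p; nia.
Qed.

Lemma rising_ge m n : (n.+1 ^ m <= rising m n)%N.
Proof.
rewrite -[X in (_ ^ X)%N]card_ord -prod_nat_const; apply: leq_prod => i _.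
exact: leq_addr.
Qed.

Lemma rising_le m n : (rising m n <= m`! * n.+1 ^ m)%N.
Proof.
rewrite /rising; elim: m => [|m IH]; first by rewrite big_ord0.
rewrite big_ord_recr /= factS expnSr.
apply: (@leq_trans (m`! * n.+1 ^ m * (m.+1 * n.+1))); last by nia.
by apply: leq_mul => //; nia.
Qed.

(** Write x = y' + m y / (z - l) in terms of Y = y / (z - l): it becomes the
    recurrence l (n+1) Y_(n+1) = (n+1+m) Y_n - x_n, with homogeneous solution
    l^(-n) (n+1)...(n+m).  That solution grows like n^m and lies in no W_(s+1) with
    s < m, so the constant of variation is forced to be the full tail series, and
    the dual Hardy inequality puts the result in W_(s+1).  Finally
    y_(n+1) = (x_n - m Y_n) / (n+1) gains one power of n. *)
Lemma twist_onto (R : realType) s (l : R[i]) m (x : nat -> R[i]) :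
  normc l = 1 -> (s < m)%N -> wl2 s.+1 x ->
  exists2 y, wl2 s y & twist l m y = x.
Proof.
move=> l1 sm hx.
have l0 : l != 0.
  by apply/eqP => l0; move: l1; rewrite l0 normc0 => /eqP; rewrite eq_sym oner_eq0.
pose u n := normc (x n) / n.+1%:R ^+ s.+1.
have u0 n : 0 <= u n by rewrite divr_ge0 ?normc_ge0 ?exprn_ge0.
pose v n := u n / n.+1%:R.
have v0 n : 0 <= v n by rewrite divr_ge0.
have [sv l2v] := l2_tail u0 hx; rewrite -/v in sv l2v.
pose c n := l ^+ n * x n / (n.+1%:R * (rising m n.+1)%:R).
pose tail n := csum c - \sum_(0 <= k < n) c k.
pose Y n := l ^- n * (rising m n)%:R * tail n.
have lX n : normc (l ^+ n) = 1 by rewrite normcX l1 expr1n.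
have cE n : normc (c n) = normc (x n) / (n.+1%:R * (rising m n.+1)%:R).
  rewrite /c !normcM normcV.
  by rewrite normcM !normc_nat lX mul1r.
(* after division by (n+1)^(s+1), the size of Y_n is at most m! times the tail of v:
   the quotient ((n+1)/(k+1))^(m-s-1) is at most 1 for k >= n because s < m *)
have cv n k : (n <= k)%N ->
    normc (c k) <= m`!%:R * n.+1%:R ^+ s.+1 / (rising m n)%:R * v k.
  move=> nk; rewrite cE /v /u.
  rewrite -[normc (x k) / _ / _]mulrA mulrCA ler_wpM2l ?normc_ge0//.
  have r0 j : 0 < (rising m j)%:R :> R by rewrite ltr0n rising_gt0.
  have k0 : 0 < k.+1%:R ^+ s.+1 :> R by rewrite exprn_gt0.
  have key : (rising m n * k.+1 ^ s.+1 <= m`! * n.+1 ^ s.+1 * rising m k.+1)%N.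
    apply: (@leq_trans (m`! * n.+1 ^ m * k.+1 ^ s.+1)).
      by rewrite leq_mul2r rising_le orbT.
    rewrite -!mulnA leq_mul2l; apply/orP; right.
    apply: (@leq_trans (n.+1 ^ s.+1 * k.+1 ^ m)).
      rewrite -(subnKC sm) !expnD -!mulnA leq_mul2l mulnC.
      apply/orP; right; rewrite leq_mul2l; apply/orP; right.
      by case: (m - s.+1)%N => // e; rewrite leq_exp2r.
    rewrite leq_mul2l; apply/orP; right.
    by apply: leq_trans (rising_ge _ _); rewrite leq_exp2r ?leqnSn// (leq_trans _ sm).
  rewrite -(ler_nat R) !natrM !natrX in key.
  have := r0 n; have := r0 k.+1; have : 0 < k.+1%:R :> R by [].
  move: key k0; move: (k.+1%:R ^+ s.+1) (n.+1%:R ^+ s.+1) m`!%:R => q p f.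
  move: (k.+1%:R) (rising m n)%:R (rising m k.+1)%:R => a r b key q0 a0 b0 rr.
  rewrite -subr_ge0.
  have -> : f * p / r * (q^-1 / a) - (a * b)^-1 = (f * p * b - r * q) / (a * b * r * q).
    by field; rewrite !gt_eqF.
  by rewrite divr_ge0 ?subr_ge0// !mulr_ge0// ltW.
have sc : bounded_sums (fun k => normc (c k)).
  have [C hC] := sv; exists (m`!%:R * 1%:R ^+ s.+1 / (rising m 0)%:R * C) => N.
  apply: le_trans (_ : m`!%:R * 1%:R ^+ s.+1 / (rising m 0)%:R * \sum_(k < N) v k <= _).
    by rewrite mulr_sumr ler_sum// => k _; exact: cv.
  by rewrite ler_wpM2l.
have tailB n : normc (tail n) <= m`!%:R * n.+1%:R ^+ s.+1 / (rising m n)%:R *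
    (limn (series v) - \sum_(k < n) v k).
  apply: csum_tail => // N nN.
  apply: (@le_trans _ _ (m`!%:R * n.+1%:R ^+ s.+1 / (rising m n)%:R *
    \sum_(n <= k < N) v k)).
    rewrite mulr_sumr big_nat_cond [X in _ <= X]big_nat_cond.
    by apply: ler_sum => k /andP[/andP[nk _] _]; exact: cv.
  rewrite ler_wpM2l//.
  rewrite lerBrDl -(big_mkord xpredT) -big_cat_nat//= big_mkord.
  exact: bounded_sums_le_lim.
have wY : wl2 s.+1 Y.
  apply: (l2_dom (c := m`!%:R)) l2v => n.
  rewrite divr_ge0 ?normc_ge0 ?exprn_ge0//= ler_pdivrMr ?exprn_gt0//.
  rewrite /Y !normcM normcV lX invr1 mul1r normc_nat.
  rewrite -ler_pdivlMl ?ltr0n ?rising_gt0//; apply: le_trans (tailB n) _.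
  by rewrite le_eqVlt; apply/orP; left; apply/eqP; ring.
have YS n : n.+1%:R * (Y n - l * Y n.+1) + m%:R * Y n = x n.
  have tE : tail n = tail n.+1 + c n.
    by rewrite /tail big_nat_recr //= opprD addrA subrK.
  have rE : n.+1%:R * (rising m n.+1)%:R = (n.+1%:R + m%:R) * (rising m n)%:R :> R[i].
    by rewrite -natrM risingS natrM natrD.
  have r0 : (rising m n.+1)%:R != 0 :> R[i] by rewrite pnatr_eq0 -lt0n rising_gt0.
  have r1 : n.+1%:R + m%:R != 0 :> R[i] by rewrite -natrD pnatr_eq0.
  have -> : n.+1%:R * (Y n - l * Y n.+1) + m%:R * Y n =
      (n.+1%:R + m%:R) * Y n - l * (n.+1%:R * Y n.+1) by ring.
  have -> : n.+1%:R * Y n.+1 = l ^- n.+1 * (n.+1%:R * (rising m n.+1)%:R) * tail n.+1.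
    by rewrite /Y; ring.
  rewrite rE /Y tE /c rE exprS invfM.
  have ln0 : l ^+ n != 0 by rewrite expf_neq0.
  have r2 : (rising m n)%:R != 0 :> R[i] by rewrite pnatr_eq0 -lt0n rising_gt0.
  move: (n.+1%:R + m%:R) (rising m n)%:R (l ^+ n) r1 r2 ln0 => q r e q0 rn0 e0.
  by field; rewrite q0 rn0 e0 l0.
(* y = (z - l) Y *)
exists (mulXsub l Y); last first.
  rewrite /twist mulXsubK//; apply/funext => n.
  by rewrite -[RHS]YS !addrfctE.
apply/l2_shift.
have := l2D hx (wl2_scale m%:R wY); apply: (l2_dom (c := 1)) => n.
rewrite divr_ge0 ?normc_ge0 ?exprn_ge0//= mul1r -mulrDl.
have -> : mulXsub l Y n.+1 = (x n - m%:R * Y n) / n.+1%:R.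
  by rewrite -YS addrK [RHS]mulrC mulKf// pnatr_eq0.
rewrite normcM normcV normc_nat.
apply: (@le_trans _ _ ((normc (x n) + normc (m%:R * Y n)) / n.+1%:R / n.+2%:R ^+ s)).
  by rewrite !ler_wpM2r// normcB.
rewrite -!mulrA ler_wpM2l ?addr_ge0 ?normc_ge0// exprS invfM ler_wpM2l//.
by rewrite lef_pV2 ?posrE ?exprn_gt0// lerXn2r ?nnegrE// ler_nat.
Qed.

(** * Power series in the unit disc *)

(** Absolute convergence in the open unit disc, expressed with radii so that the
    estimates remain between real sequences. *)
Definition absconv (R : realType) (x : nat -> R[i]) : Prop :=
  forall r : R, 0 <= r < 1 -> bounded_sums (fun n => normc (x n) * r ^+ n).

Lemma bounded_sums_dom (R : realType) (c : R) (u v : nat -> R) : 0 <= c ->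
  (forall n, u n <= c * v n) -> bounded_sums v -> bounded_sums u.
Proof.
move=> c0 uv [C hC]; exists (c * C) => N.
apply: (@le_trans _ _ (c * \sum_(n < N) v n)); last by rewrite ler_wpM2l.
by rewrite mulr_sumr ler_sum.
Qed.

Lemma geometric_sum_le (R : realType) (q : R) n : 0 <= q < 1 ->
  \sum_(k < n) q ^+ k <= (1 - q)^-1.
Proof.
move=> /andP[q0 q1]; rewrite -[leRHS]mul1r ler_pdivlMr ?subr_gt0//.
have := subrX1 q n; have := exprn_ge0 n q0; nra.
Qed.

Lemma absconv_bounded (R : realType) (x : nat -> R[i]) (K : R) :
  (forall n, normc (x n) <= K) -> absconv x.
Proof.
move=> xK r r01; exists (K * (1 - r)^-1) => N.
have K0 : 0 <= K by apply: le_trans (xK 0%N); exact: normc_ge0.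
apply: le_trans (ler_wpM2l K0 (geometric_sum_le N r01)).
rewrite mulr_sumr ler_sum// => n _; rewrite ler_wpM2r// exprn_ge0//.
by case/andP: r01.
Qed.

(** Trade a larger radius p for the factor n+1: (n+1) q^n is at most
    1 + q + ... + q^n, which is bounded when q = r / p < 1. *)
Lemma absconv_mulSn (R : realType) (x : nat -> R[i]) :
  absconv x -> absconv (fun n => n.+1%:R * x n).
Proof.
move=> hx r /andP[r0 r1]; pose p := (1 + r) / 2.
have p0 : 0 < p by rewrite /p; lra.
have p1 : 0 <= p < 1 by rewrite /p; lra.
have q1 : 0 <= r / p < 1.
  by rewrite divr_ge0 ?(ltW p0)//= ltr_pdivrMr// mul1r /p; lra.
apply: (bounded_sums_dom (c := (1 - r / p)^-1)) (hx p p1) => [|n].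
  rewrite invr_ge0 subr_ge0 ltW//.
  by case/andP: q1.
rewrite normcM normc_nat.
apply: (@le_trans _ _ ((\sum_(k < n.+1) (r / p) ^+ k) * (normc (x n) * p ^+ n))); last first.
  by rewrite ler_wpM2r ?geometric_sum_le// mulr_ge0 ?normc_ge0// exprn_ge0// ltW.
have -> : r ^+ n = (r / p) ^+ n * p ^+ n by rewrite -exprMn divfK// gt_eqF.
rewrite (_ : _ * (_ * _) = (n.+1%:R * (r / p) ^+ n) * (normc (x n) * p ^+ n)); last by ring.
rewrite ler_wpM2r ?mulr_ge0 ?normc_ge0 ?exprn_ge0 ?(ltW p0)//.
rewrite mulrC -[X in X%:R](card_ord n.+1) mulr_natr -sumr_const ler_sum// => k _.
case/andP: q1 => q0 /ltW q1.
by rewrite ler_wiXn2l// -ltnS ltn_ord.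
Qed.

Lemma absconv_shift (R : realType) (x : nat -> R[i]) :
  absconv x -> absconv (fun n => x n.+1).
Proof.
move=> hx r /andP[r0 r1]; pose p := (1 + r) / 2.
have p0 : 0 < p by rewrite /p; lra.
have p1 : 0 <= p < 1 by rewrite /p; lra.
have [C hC] := hx p p1.
apply: (@bounded_sums_dom _ p^-1 _ (fun n => normc (x n.+1) * p ^+ n.+1)) => [|n|].
- by rewrite invr_ge0 ltW.
- rewrite mulrCA exprS mulKf ?gt_eqF// ler_wpM2l ?normc_ge0//.
  by rewrite lerXn2r ?nnegrE ?(ltW p0)// /p; lra.
exists C => N; apply: le_trans (hC N.+1).
by rewrite big_ord_recl lerDr mulr_ge0 ?normc_ge0.
Qed.

Lemma absconv_coef_deriv (R : realType) (x : nat -> R[i]) :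
  absconv x -> absconv (coef_deriv x).
Proof. by move=> hx; apply: absconv_mulSn; exact: absconv_shift. Qed.

Lemma absconvD (R : realType) (x y : nat -> R[i]) :
  absconv x -> absconv y -> absconv (x + y).
Proof.
move=> hx hy r r01; have [C hC] := hx r r01; have [K hK] := hy r r01.
exists (C + K) => N; apply: le_trans (lerD (hC N) (hK N)).
rewrite -big_split /=; apply: ler_sum => n _; rewrite -mulrDl.
by rewrite ler_wpM2r ?le_normcD// exprn_ge0//; case/andP: r01.
Qed.

Lemma wl2_absconv (R : realType) s (x : nat -> R[i]) : wl2 s x -> absconv x.
Proof.
move=> [C hC].
have : absconv (fun n => x n / n.+1%:R ^+ s).
  apply: (@absconv_bounded _ _ (C + 1)) => n.
  have : (normc (x n) / n.+1%:R ^+ s) ^+ 2 <= C.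
    by apply: le_trans (hC n.+1); rewrite big_ord_recr /= lerDr sumr_ge0// => i _; rewrite sqr_ge0.
  rewrite normcM normcV normcX normc_nat.
  have := sqr_ge0 (normc (x n) / n.+1%:R ^+ s - 1); nra.
elim: s {hC} => [|s IH] hs.
  by move: hs; under eq_fun do rewrite expr0 divr1.
apply: IH; have := absconv_mulSn hs.
rewrite [X in absconv X -> _](_ : _ = (fun n => x n / n.+1%:R ^+ s))//.
apply/funext => n; have n0 : n.+1%:R != 0 :> R[i] by rewrite pnatr_eq0.
by move: (n.+1%:R : R[i]) n0 => q q0; rewrite exprS invfM mulrCA mulVKf.
Qed.

Lemma normCE (R : realType) (z : R[i]) : `|z| = (normc z)%:C%C.
Proof. by []. Qed.

Lemma discE (R : realType) (z : R[i]) : disc z <-> normc z < 1.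
Proof. by rewrite /disc /= normCE -(ltcR (normc z) 1). Qed.

(** Balls of the field R[i] have radii in R[i], but only real positive ones; this
    reduces convergence to real radii. *)
Lemma cvgcP (R : realType) (T : Type) (F : set_system T) {FF : Filter F}
    (u : T -> R[i]^o) (L : R[i]^o) :
  (forall e : R, 0 < e -> \forall n \near F, normc (L - u n) < e) ->
  u @ F --> L.
Proof.
move=> h; apply/cvgrPdist_lt => -[e e'].
rewrite ltcE /= => /andP[/eqP-> e0].
near=> n; rewrite normCE (ltcR _ e); near: n; exact: h.
Unshelve. all: by end_near. Qed.

Lemma csum_cvg (R : realType) (c : nat -> R[i]) :
  bounded_sums (fun n => normc (c n)) ->
  (series (c : nat -> R[i]^o)) @ \oo --> (csum c : R[i]^o).
Proof.
move=> sc; apply: cvgcP => e e0.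
have c0 n : 0 <= normc (c n) := normc_ge0 _.
have /cvgrPdist_lt/(_ e e0) := bounded_sums_cvg c0 sc.
apply: filterS => n; apply: le_lt_trans.
rewrite /series /=; apply: csum_tail => // N nN.
rewrite ger0_norm; last by rewrite subr_ge0 big_mkord; exact: bounded_sums_le_lim.
rewrite lerBrDl -big_cat_nat//= big_mkord; exact: bounded_sums_le_lim.
Qed.

Lemma normc_lim_le (R : realType) (u : nat -> R[i]^o) (L : R[i]^o) (K : R) :
  u @ \oo --> L -> (forall n, normc (u n) <= K) -> normc L <= K.
Proof.
move=> /cvgrPdist_lt uL uK; rewrite leNgt; apply/negP => KL.
have e0 : 0 < (normc L - K)%:C%C :> R[i] by rewrite (ltcR 0) subr_gt0.
have [n _ /(_ n (leqnn _))] := uL _ e0; rewrite /= normCE (ltcR _ (_ - _)).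
apply/negP; rewrite -leNgt lerBlDr.
have -> : L = (L - u n) + u n by rewrite subrK.
apply: le_trans (le_normcD _ _) _; rewrite lerD//.
by rewrite subrK.
Qed.

Definition power_sum (R : realType) (x : nat -> R[i]) (z : R[i]) : R[i] :=
  csum (fun n => x n * z ^+ n).

Lemma power_sum_bounded_sums (R : realType) (x : nat -> R[i]) (z : R[i]) :
  absconv x -> disc z -> bounded_sums (fun n => normc (x n * z ^+ n)).
Proof.
move=> hx /discE z1; have := hx (normc z); rewrite normc_ge0 z1 => /(_ isT).
by under eq_fun do rewrite -normcX -normcM.
Qed.

Lemma power_sum_cvg (R : realType) (x : nat -> R[i]) (z : R[i]) :
  absconv x -> disc z ->
  series (fun n => x n * z ^+ n : R[i]^o) @ \oo --> (power_sum x z : R[i]^o).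
Proof. by move=> hx dz; apply: csum_cvg; exact: power_sum_bounded_sums. Qed.

Lemma power_sum_eq (R : realType) (x : nat -> R[i]) (z w : R[i]) :
  absconv x -> disc z ->
  series (fun n => x n * z ^+ n : R[i]^o) @ \oo --> (w : R[i]^o) -> w = power_sum x z.
Proof.
by move=> hx dz hw; have := power_sum_cvg hx dz; apply: (cvg_unique _ hw).
Qed.

Lemma power_sumD (R : realType) (x y : nat -> R[i]) (z : R[i]) :
  absconv x -> absconv y -> disc z ->
  power_sum (x + y) z = power_sum x z + power_sum y z.
Proof.
move=> hx hy dz; apply/esym/power_sum_eq => //; first exact: absconvD.
rewrite (_ : series _ = series (fun n => x n * z ^+ n : R[i]^o) +
                        series (fun n => y n * z ^+ n : R[i]^o)).
  exact: cvgD (power_sum_cvg hx dz) (power_sum_cvg hy dz).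
by rewrite -seriesD; congr series; apply/funext => n; rewrite !addrfctE mulrDl.
Qed.

Lemma power_sum_mulXsub (R : realType) (l : R[i]) (x : nat -> R[i]) (z : R[i]) :
  absconv x -> absconv (mulXsub l x) -> disc z ->
  power_sum (mulXsub l x) z = (z - l) * power_sum x z.
Proof.
move=> hx hm dz; apply/esym/power_sum_eq => //; rewrite -cvg_shiftS.
have h0 := power_sum_cvg hx dz.
have h1 : (fun n => series (fun n => x n * z ^+ n : R[i]^o) n.+1) @ \oo -->
  (power_sum x z : R[i]^o) by rewrite (cvg_shiftS (series _)).
rewrite mulrBl.
rewrite (_ : (fun n => _) = (fun n => z *: series (fun n => x n * z ^+ n : R[i]^o) n -
    l *: series (fun n => x n * z ^+ n : R[i]^o) n.+1)).
  exact: cvgB (cvgZl_tmp (k := z) h0) (cvgZl_tmp (k := l) h1).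
apply/funext => n.
rewrite /series /= !big_mkord !big_ord_recl /mulXsub /= /GRing.scale /=.
rewrite mulrDr opprD addrCA sub0r expr0 !mulr1; congr (_ + _).
rewrite !mulr_sumr -sumrB; apply: eq_bigr => i _ /=.
by rewrite /bump /= add1n exprS; ring.
Qed.

(** The factor r^2 avoids a truncated exponent n - 2.  Induction on [n], since the
    remainders satisfy e_(n+1) = (z + h) e_n + n h^2 z^(n-1). *)
Lemma expr_remainder (R : realType) (r : R) (z h : R[i]) n : 0 < r ->
  normc z <= r -> normc (z + h) <= r ->
  r ^+ 2 * normc ((z + h) ^+ n - z ^+ n - h * (n%:R * z ^+ n.-1)) <=
  n%:R ^+ 2 * normc h ^+ 2 * r ^+ n.
Proof.
move=> r0 zr zhr; elim: n => [|n IH].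
  by rewrite !expr0 subrr !mul0r mulr0 subrr normc0 mulr0 expr0n /= !mul0r.
set e := (z + h) ^+ n - _ - _ in IH.
have -> : (z + h) ^+ n.+1 - z ^+ n.+1 - h * (n.+1%:R * z ^+ n.+1.-1) =
    (z + h) * e + n%:R * h ^+ 2 * z ^+ n.-1.
  rewrite /e /= -natr1; case: n {IH e} => [|n] /=; first by rewrite !expr0 expr1; ring.
  by rewrite !exprS; ring.
have zn : r ^+ 2 * normc (n%:R * h ^+ 2 * z ^+ n.-1) <= n%:R * normc h ^+ 2 * r ^+ n.+1.
  rewrite !normcM !normcX normc_nat.
  case: n {IH e} => [|n]; first by rewrite !mul0r mulr0.
  have zrn : normc z ^+ n <= r ^+ n by rewrite lerXn2r ?nnegrE ?normc_ge0// ltW.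
  rewrite /= [leLHS](_ : _ = n.+1%:R * normc h ^+ 2 * r ^+ 2 * normc z ^+ n); last by ring.
  rewrite [leRHS](_ : _ = n.+1%:R * normc h ^+ 2 * r ^+ 2 * r ^+ n); last by rewrite !exprS; ring.
  by rewrite ler_wpM2l// !mulr_ge0 ?exprn_ge0 ?normc_ge0 ?(ltW r0).
have he : r ^+ 2 * normc ((z + h) * e) <= r * (n%:R ^+ 2 * normc h ^+ 2 * r ^+ n).
  rewrite normcM mulrCA; apply: ler_pM => //.
    exact: normc_ge0.
  by rewrite mulr_ge0 ?sqr_ge0 ?normc_ge0.
apply: (@le_trans _ _ (r * (n%:R ^+ 2 * normc h ^+ 2 * r ^+ n) +
                       n%:R * normc h ^+ 2 * r ^+ n.+1)).
  apply: le_trans (lerD he zn); rewrite -mulrDr ler_wpM2l ?sqr_ge0//.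
  exact: le_normcD.
have : 0 <= normc h ^+ 2 * r ^+ n.+1 by rewrite mulr_ge0 ?exprn_ge0 ?normc_ge0// ltW.
have n0 : 0 <= n%:R :> R by [].
rewrite (_ : r * _ = n%:R ^+ 2 * (normc h ^+ 2 * r ^+ n.+1)); last first.
  by rewrite [r ^+ n.+1]exprS; ring.
rewrite -natr1 -!mulrA; move: (n%:R) n0 (normc h ^+ 2 * r ^+ n.+1) => t t0 a a0; nra.
Qed.

(** Sum [expr_remainder] against the coefficients; n^2 is absorbed by applying
    [absconv_mulSn] twice. *)
Lemma power_sum_remainder (R : realType) (x : nat -> R[i]) (r : R) :
  absconv x -> 0 < r < 1 -> exists2 K, 0 <= K & forall z h,
  normc z <= r -> normc (z + h) <= r ->
  normc (power_sum x (z + h) - power_sum x z - h * power_sum (coef_deriv x) z) <= K * normc h ^+ 2.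
Proof.
move=> hx /andP[r0 r1].
have [C hC] : bounded_sums (fun n => normc (n.+1%:R * (n.+1%:R * x n)) * r ^+ n).
  by apply: absconv_mulSn; [exact: absconv_mulSn|rewrite (ltW r0)].
have C0 : 0 <= C by apply: le_trans (hC 0%N); rewrite big_ord0.
exists (C / r ^+ 2) => [|z h zr zhr]; first by rewrite divr_ge0 ?sqr_ge0.
have dz : disc z by apply/discE; exact: le_lt_trans r1.
have dzh : disc (z + h) by apply/discE; exact: le_lt_trans r1.
have h1 : (fun n => series (fun n => x n * z ^+ n : R[i]^o) n.+1) @ \oo -->
  (power_sum x z : R[i]^o) by rewrite (cvg_shiftS (series _)); exact: power_sum_cvg.
have h2 : (fun n => series (fun n => x n * (z + h) ^+ n : R[i]^o) n.+1) @ \oo -->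
  (power_sum x (z + h) : R[i]^o) by rewrite (cvg_shiftS (series _)); exact: power_sum_cvg.
have h3 := power_sum_cvg (absconv_coef_deriv hx) dz.
apply: normc_lim_le (cvgB (cvgB h2 h1) (cvgZl_tmp (k := h) h3)) _ => n.
rewrite !opprfctE !addrfctE /series /= !big_mkord /GRing.scale /= -sumrB mulr_sumr.
rewrite [X in _ - X](_ : _ = \sum_(i < n.+1) h * (x i * (i%:R * z ^+ i.-1))); last first.
  rewrite [RHS]big_ord_recl /= mul0r !mulr0 add0r; apply: eq_bigr => i _ /=.
  by rewrite /coef_deriv /bump /= add1n; ring.
rewrite -sumrB; apply: le_trans (normc_sum _ _ _) _.
rewrite mulrAC ler_pdivlMr ?exprn_gt0// mulr_suml.
apply: le_trans (ler_wpM2r (sqr_ge0 _) (hC n.+1)); rewrite mulr_suml.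
apply: ler_sum => i _.
rewrite (_ : _ - _ = x i * ((z + h) ^+ i - z ^+ i - h * (i%:R * z ^+ i.-1))); last by ring.
rewrite normcM -mulrA [X in _ * X]mulrC.
apply: le_trans (ler_wpM2l (normc_ge0 _) (expr_remainder i r0 zr zhr)) _.
rewrite !normcM normc_nat.
have : i%:R ^+ 2 <= i.+1%:R ^+ 2 :> R by rewrite lerXn2r ?nnegrE// ler_nat.
have : 0 <= normc (x i) * (normc h ^+ 2 * r ^+ i).
  by rewrite !mulr_ge0 ?exprn_ge0 ?normc_ge0// ltW.
move: (i%:R) (i.+1%:R) (normc (x i)) (normc h ^+ 2) (r ^+ i) => a b c d e; nra.
Qed.

Lemma power_sum_derive (R : realType) (x : nat -> R[i]) (f : R[i]^o -> R[i]^o) (z : R[i]^o) :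
  absconv x -> (forall w, disc w -> f w = power_sum x w) -> disc z ->
  (fun h => h^-1 *: (f (h + z) - f z)) @ 0^' --> (power_sum (coef_deriv x) z : R[i]^o).
Proof.
move=> hx fE dz; have /discE z1 := dz.
pose r := (1 + normc z) / 2.
have z0 := normc_ge0 z.
have r01 : 0 < r < 1 by rewrite /r; lra.
have [K K0 hK] := power_sum_remainder hx r01.
apply: cvgcP => e e0.
(* the first bound keeps z + h in the disc of radius r, the second one beats K |h| *)
pose d := Num.min ((1 - normc z) / 2) (e / (K + 1)).
have d0 : 0 < d by rewrite lt_min divr_gt0 ?subr_gt0//= divr_gt0// ltr_wpDl.
have dc : 0 < d%:C%C :> R[i] by rewrite (ltcR 0).
near=> h.
have h0 : h != 0 by near: h; exact: nbhs_dnbhs_neq.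
have hd : normc h < d.
  rewrite -(ltcR _ d) -normCE; near: h; apply: dnbhs0_lt; exact: dc.
have /andP[hd1 hd2] : (normc h < (1 - normc z) / 2) && (normc h < e / (K + 1)).
  by rewrite -lt_min.
have zh : normc (z + h) <= r.
  by apply: le_trans (le_normcD _ _) _; rewrite /r; lra.
have dzh : disc (z + h).
  by apply/discE; apply: le_lt_trans zh _; case/andP: r01.
rewrite [h + z]addrC !fE//.
have hp : 0 < normc h.
  by rewrite lt_neqAle normc_ge0 andbT eq_sym; apply: contra_neq h0 => /eq0_normc.
have zr : normc z <= r by rewrite /r; lra.
have := hK z h zr zh.
rewrite /GRing.scale /=.
move: (power_sum x (z + h)) (power_sum x z) (power_sum (coef_deriv x) z) => a b c.
have -> : c - h^-1 * (a - b) = - ((a - b - h * c) / h).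
  by rewrite mulrBl [h * c]mulrC mulfK// [_ / h]mulrC opprB.
rewrite normcN normcM normcV => hw.
rewrite ltr_pdivrMr//; apply: le_lt_trans hw _.
rewrite expr2 mulrA ltr_pM2r//; rewrite ltr_pdivlMr in hd2; last by rewrite ltr_wpDl.
by have := normc_ge0 h; nra.
Unshelve. all: by end_near. Qed.

Lemma power_sum_derivable (R : realType) (x : nat -> R[i]) (f : R[i]^o -> R[i]^o) :
  absconv x -> (forall w, disc w -> f w = power_sum x w) -> holomorphic_disc f.
Proof.
move=> hx fE z dz; apply/cvg_ex; exists (power_sum (coef_deriv x) z : R[i]^o).
have := power_sum_derive hx fE dz; apply: cvg_trans; apply: near_eq_cvg; near=> h.
by rewrite /GRing.scale /= mulr1.
Unshelve. all: by end_near. Qed.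

Lemma power_sum_derive1n (R : realType) (x : nat -> R[i]) (f : R[i]^o -> R[i]^o) m :
  absconv x -> (forall w, disc w -> f w = power_sum x w) ->
  forall w, disc w -> (f^`(m)%classic w = power_sum (iter m (@coef_deriv R) x) w).
Proof.
move=> hx fE; have hm : forall k, absconv (iter k (@coef_deriv R) x).
  by elim=> //= k; exact: absconv_coef_deriv.
elim: m => [|m IH] w dw; first by rewrite /= fE.
rewrite derive1nS /derive1 /=.
by have := power_sum_derive (hm m) IH dw; exact: cvg_lim.
Qed.

(** * Rotations and dilations of planar Lebesgue measure *)

(** By uniqueness of Lebesgue measure it suffices to compare the two sides on
    half-open intervals. *)
Lemma ge0_integral_affine (R : realType) (a b : R) (f : measurableTypeR R -> \bar R) :
  0 < a -> measurable_fun setT f -> (forall x, (0 <= f x)%E) ->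
  (\int[lebesgue_measure]_x f x =
   a%:E * \int[lebesgue_measure]_x f ((a * x + b)%R : measurableTypeR R))%E.
Proof.
move=> a0 mf f0.
pose phi (x : measurableTypeR R) : measurableTypeR R := a * x + b.
have mphi : measurable_fun setT phi.
  apply: measurable_funD; last exact: measurable_cst.
  by apply: measurable_funM; [exact: measurable_cst|exact: measurable_id].
pose nu0 := mscale (NngNum (ltW a0)) (pushforward lebesgue_measure phi).
pose nu : {measure set (measurableTypeR R) -> \bar R} := nu0 mphi.
have E (A : set (measurableTypeR R)) : measurable A -> lebesgue_measure A = nu A.
  apply: lebesgue_measure_unique => _ [[c d]] _ <-.
  rewrite /= /mscale /= /pushforward.
  rewrite (_ : phi @^-1` _ = `](c - b) / a, (d - b) / a]%classic); last first.
    apply/seteqP; split=> x /=; rewrite !in_itv /= /phi ltr_pdivrMr// ler_pdivlMr//;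
    by rewrite ltrBlDr lerBrDr [x * a]mulrC.
  rewrite !lebesgue_measure_itv /= !lte_fin ltr_pM2r ?invr_gt0// ltrD2r.
  case: ifPn => _; last by rewrite mule0.
  by rewrite -EFinD -EFinM; congr EFin; field; rewrite gt_eqF.
transitivity (\int[nu]_x f x)%E.
  by apply: eq_measure_integral => A mA _; exact: E.
rewrite ge0_integral_mscale//; congr (_ * _)%E.
by rewrite (ge0_integral_pushforward mphi).
Qed.

Lemma ge0_integral_shear1 (R : realType) (t : R) (f : plane R -> \bar R) :
  measurable_fun setT f -> (forall w, (0 <= f w)%E) ->
  (\int[mu2 R]_w f w = \int[mu2 R]_w f ((w.1 + t * w.2)%R, w.2))%E.
Proof.
move=> mf f0.
have m1 : measurable_fun setT (fun w : plane R => (w.1 + t * w.2, w.2) : plane R).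
  apply: measurable_fun_pair; last exact: measurable_snd.
  apply: measurable_funD; first exact: measurable_fst.
  by apply: measurable_funM; [exact: measurable_cst|exact: measurable_snd].
rewrite (fubini_tonelli2 f mf f0).
rewrite (fubini_tonelli2 _ (measurableT_comp mf m1) (fun w => f0 _)).
apply: eq_integral => y _; rewrite /fubini_G /=.
have mfy : measurable_fun setT (fun x => f (x, y)).
  exact: measurable_fun_pair1.
rewrite (@ge0_integral_affine _ 1 (t * y) (fun x => f (x, y)))// mul1e.
by under eq_integral do rewrite mul1r.
Qed.

Lemma ge0_integral_shear2 (R : realType) (t : R) (f : plane R -> \bar R) :
  measurable_fun setT f -> (forall w, (0 <= f w)%E) ->
  (\int[mu2 R]_w f w = \int[mu2 R]_w f (w.1, (w.2 + t * w.1)%R))%E.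
Proof.
move=> mf f0.
have m1 : measurable_fun setT (fun w : plane R => (w.1, w.2 + t * w.1) : plane R).
  apply: measurable_fun_pair; first exact: measurable_fst.
  apply: measurable_funD; first exact: measurable_snd.
  by apply: measurable_funM; [exact: measurable_cst|exact: measurable_fst].
rewrite (fubini_tonelli1 f mf f0).
rewrite (fubini_tonelli1 _ (measurableT_comp mf m1) (fun w => f0 _)).
apply: eq_integral => x _; rewrite /fubini_F /=.
have mfx : measurable_fun setT (fun y => f (x, y)).
  exact: measurable_fun_pair2.
rewrite (@ge0_integral_affine _ 1 (t * x) (fun y => f (x, y)))// mul1e.
by under eq_integral do rewrite mul1r.
Qed.

Lemma ge0_integral_dilate (R : realType) (a : R) (f : plane R -> \bar R) :
  0 < a -> measurable_fun setT f -> (forall w, (0 <= f w)%E) ->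
  (\int[mu2 R]_w f w = (a ^+ 2)%:E * \int[mu2 R]_w f ((a * w.1)%R, (a * w.2)%R))%E.
Proof.
move=> a0 mf f0.
have m1 : measurable_fun setT (fun w : plane R => (a * w.1, a * w.2) : plane R).
  apply: measurable_fun_pair.
    by apply: measurable_funM; [exact: measurable_cst|exact: measurable_fst].
  by apply: measurable_funM; [exact: measurable_cst|exact: measurable_snd].
have mg := measurableT_comp mf m1.
rewrite (fubini_tonelli1 f mf f0) (fubini_tonelli1 _ mg (fun w => f0 _)).
rewrite (ge0_integral_affine 0 a0 (measurable_fun_fubini_tonelli_F f mf f0)); last first.
  by move=> x; apply: integral_ge0.
rewrite expr2 EFinM -muleA; congr (_ * _)%E.
rewrite -(ge0_integralZl _ measurableT (measurable_fun_fubini_tonelli_F _ mg (fun w => f0 _))); last 2 first.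
- by move=> x _; apply: integral_ge0 => y _; exact: f0.
- by rewrite lee_fin ltW.
apply: eq_integral => x _; rewrite /fubini_F /= addr0.
have mfx : measurable_fun setT (fun y => f (a * x, y)).
  exact: measurable_fun_pair2.
rewrite (@ge0_integral_affine _ a 0 (fun y => f (a * x, y)))//.
by under eq_integral do rewrite addr0.
Qed.

Definition cmul_plane (R : realType) (o : R[i]) (w : plane R) : plane R :=
  (complex.Re o * w.1 - complex.Im o * w.2, complex.Im o * w.1 + complex.Re o * w.2).

Lemma measurable_cmul_plane (R : realType) (o : R[i]) :
  measurable_fun setT (cmul_plane o).
Proof.
apply: measurable_fun_pair; rewrite /cmul_plane /comp /=.
  apply: measurable_funB; apply: measurable_funM; try exact: measurable_cst.
    exact: measurable_fst.
  exact: measurable_snd.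
apply: measurable_funD; apply: measurable_funM; try exact: measurable_cst.
  exact: measurable_fst.
exact: measurable_snd.
Qed.

(** The matrix of a rotation with cosine c and sine s is the product of the
    horizontal shear by (c-1)/s, the vertical shear by s and the same horizontal
    shear; this needs s <> 0. *)
Lemma ge0_integral_rotate (R : realType) (o : R[i]) (f : plane R -> \bar R) :
  normc o = 1 -> complex.Im o != 0 ->
  measurable_fun setT f -> (forall w, (0 <= f w)%E) ->
  (\int[mu2 R]_w f (cmul_plane o w) = \int[mu2 R]_w f w)%E.
Proof.
move=> o1 o2 mf f0; move: (normc_sqr o); rewrite o1 expr1n => cs.
rewrite /cmul_plane; move: (complex.Re o) (complex.Im o) cs o2 => c s cs s0.
pose a := (c - 1) / s.
have ms1 t : measurable_fun setT (fun w : plane R => (w.1 + t * w.2, w.2) : plane R).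
  apply: measurable_fun_pair; last exact: measurable_snd.
  apply: measurable_funD; first exact: measurable_fst.
  by apply: measurable_funM; [exact: measurable_cst|exact: measurable_snd].
have ms2 t : measurable_fun setT (fun w : plane R => (w.1, w.2 + t * w.1) : plane R).
  apply: measurable_fun_pair; first exact: measurable_fst.
  apply: measurable_funD; first exact: measurable_snd.
  by apply: measurable_funM; [exact: measurable_cst|exact: measurable_fst].
have m1 := measurableT_comp mf (ms1 a); have m2 := measurableT_comp m1 (ms2 s).
rewrite [RHS](ge0_integral_shear1 a)//.
rewrite [RHS](ge0_integral_shear2 s)// [RHS](ge0_integral_shear1 a)//.
have as_ : a * s = c - 1 by rewrite /a divfK.
have asE : a * (2 + a * s) = - s.
  by apply: (mulIf s0); rewrite mulrAC as_; nra.
apply: eq_integral => -[x y] _ /=; congr (f (_, _)).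
  rewrite [RHS](_ : _ = (1 + a * s) * x + (a * (2 + a * s)) * y); last by ring.
  by rewrite asE as_; ring.
rewrite [RHS](_ : _ = (1 + a * s) * y + s * x); last by ring.
by rewrite as_; ring.
Qed.

(** * Radial integrals and the beta function *)

Definition sqmod (R : realType) (w : plane R) : measurableTypeR R := w.1 ^+ 2 + w.2 ^+ 2.

Lemma measurable_sqmod (R : realType) : measurable_fun setT (@sqmod R).
Proof.
apply: measurable_funD; apply: measurable_funX.
  exact: measurable_fst.
exact: measurable_snd.
Qed.

Definition cball (R : realType) (t : R) : set (plane R) := [set w | sqmod w <= t].

Lemma measurable_cball (R : realType) (t : R) : measurable (cball t).
Proof.
rewrite (_ : cball t = setT `&` (@sqmod R @^-1` `]-oo, t]%classic)).
  exact: measurable_sqmod.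
by rewrite setTI; apply/seteqP; split => w; rewrite /cball /= in_itv.
Qed.

(** The area of a disc is proportional to its squared radius; the value of the
    constant is never used, only that it is positive and finite. *)
Lemma cball_dilate (R : realType) (t : R) : 0 < t ->
  (mu2 R (cball t) = t%:E * mu2 R (cball 1))%E.
Proof.
move=> t0.
have mind (s : R) : measurable_fun setT (fun w => (\1_(cball s) w)%:E : \bar R).
  by apply/measurable_EFinP; apply: measurable_indic; exact: measurable_cball.
have E (s : R) : (mu2 R (cball s) = \int[mu2 R]_w (\1_(cball s) w)%:E)%E.
  by rewrite integral_indic ?setIT//; exact: measurable_cball.
rewrite !E (@ge0_integral_dilate _ (Num.sqrt t)) ?sqrtr_gt0//.
rewrite sqr_sqrtr ?(ltW t0)//; congr (_ * _)%E; apply: eq_integral => w _.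
congr EFin; rewrite !indicE; congr (nat_of_bool _)%:R.
have tw : (t * (w.1 ^+ 2 + w.2 ^+ 2) <= t) = (w.1 ^+ 2 + w.2 ^+ 2 <= 1).
  by rewrite -[X in _ <= X]mulr1 ler_pM2l.
apply/idP/idP => /set_mem; rewrite /cball /sqmod /= => h; apply/mem_set;
  move: h; by rewrite /= !exprMn sqr_sqrtr ?(ltW t0)// -mulrDr tw.
Qed.

Lemma cball1_fin (R : realType) : (mu2 R (cball 1) < +oo)%E.
Proof.
pose I : set (measurableTypeR R) := `[-1, 1]%classic.
have mI : measurable I by exact: measurable_itv.
apply: (@le_lt_trans _ _ (mu2 R (I `*` I))).
  apply: le_measure; rewrite ?inE; first exact: measurable_cball.
    exact: measurableX.
  move=> [x y]; rewrite /cball /sqmod /I /= !in_itv /= => h; split; apply/andP; split; nra.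
rewrite product_measure1E// /I /= lebesgue_measure_itv /= lte_fin.
by case: ifP => _; rewrite ?mul0e// -!EFinD -EFinM ltry.
Qed.

Lemma cball1_gt0 (R : realType) : (0 < mu2 R (cball 1))%E.
Proof.
pose I : set (measurableTypeR R) := `[0, 2^-1]%classic.
have mI : measurable I by exact: measurable_itv.
apply: (@lt_le_trans _ _ (mu2 R (I `*` I))).
  rewrite product_measure1E// /I /= lebesgue_measure_itv /= lte_fin.
  rewrite invr_gt0 ltr0n /= oppr0 adde0 -EFinM lte_fin.
  by rewrite mulr_gt0// invr_gt0.
apply: le_measure; rewrite ?inE; [exact: measurableX|exact: measurable_cball|].
move=> [x y]; rewrite /cball /sqmod /I /= !in_itv /= => -[/andP[x0 x1] /andP[y0 y1]].
have h2 : (2:R)^-1 = 1 / 2 by rewrite div1r.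
by rewrite h2 in x1 y1; nra.
Qed.

Lemma cball0 (R : realType) : mu2 R (cball 0) = 0%E.
Proof.
have -> : cball (0 : R) = [set 0] `*` [set 0].
  apply/seteqP; split => -[x y]; rewrite /cball /sqmod /=.
    move=> h; have x2 := sqr_ge0 x; have y2 := sqr_ge0 y.
    have /eqP : x ^+ 2 = 0 by lra.
    have /eqP : y ^+ 2 = 0 by lra.
    by rewrite !sqrf_eq0 => /eqP-> /eqP->.
  by move=> [-> ->]; rewrite !expr0n addr0.
rewrite product_measure1E//; try exact: measurable_set1.
by rewrite /= lebesgue_measure_set1 mul0e.
Qed.

Lemma cball_neg (R : realType) (t : R) : t < 0 -> cball t = set0.
Proof.
move=> t0; apply/seteqP; split => // w; rewrite /cball /sqmod /=.
by have := sqr_ge0 w.1; have := sqr_ge0 w.2; lra.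
Qed.

Lemma measure_cball (R : realType) (t : R) :
  mu2 R (cball t) = (Num.max t 0 * fine (mu2 R (cball 1)))%:E.
Proof.
have fb : mu2 R (cball 1) \is a fin_num by rewrite ge0_fin_numE// cball1_fin.
have [t0|t0|->] := ltgtP t 0.
- by rewrite cball_neg// measure0 mul0r.
- by rewrite cball_dilate// EFinM fineK.
- by rewrite cball0 mul0r.
Qed.

(** The image of planar measure under the squared modulus gives the interval from
    a to b the area of an annulus, which is proportional to b - a by [measure_cball]. *)
Lemma ge0_integral_radial (R : realType) (phi : measurableTypeR R -> \bar R) :
  measurable_fun (`[0, 1[%classic : set (measurableTypeR R)) phi ->
  (forall t, 0 <= t < 1 -> (0 <= phi t)%E) ->
  (\int[mu2 R]_(w in @sqmod R @^-1` `[0%R, 1%R[%classic) phi (sqmod w) =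
   mu2 R (cball 1) * \int[lebesgue_measure]_(t in `[0%R, 1%R[) phi t)%E.
Proof.
move=> mphi phi0.
have fb : mu2 R (cball 1) \is a fin_num by rewrite ge0_fin_numE// cball1_fin.
pose c := fine (mu2 R (cball 1)).
have c0 : 0 < c by rewrite fine_gt0// cball1_gt0 cball1_fin.
(* the image measure lives on the half-line; Lebesgue measure on the negative reals is
   added so that uniqueness of Lebesgue measure on the whole line applies *)
pose neg : set (measurableTypeR R) := `]-oo, 0[%classic.
have mneg : measurable neg by exact: measurable_itv.
have cV0 : 0 <= c^-1 by rewrite invr_ge0 ltW.
pose p := pushforward (mu2 R) (@sqmod R).
pose m0 := mscale (NngNum cV0) (pushforward (mu2 R) (@sqmod R)).
pose m1 : {measure set (measurableTypeR R) -> \bar R} := m0 (@measurable_sqmod R).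
pose m2' := mrestr (@lebesgue_measure R) mneg.
pose m2 : {measure set (measurableTypeR R) -> \bar R} := m2'.
pose nu : {measure set (measurableTypeR R) -> \bar R} := measure_add m1 m2.
have nuE (B : set (measurableTypeR R)) :
    nu B = (c^-1%:E * p B + lebesgue_measure (B `&` neg))%E := measure_addE m1 m2 B.
have E (A : set (measurableTypeR R)) : measurable A -> lebesgue_measure A = nu A.
  apply: lebesgue_measure_unique => _ [[a b]] _ <-.
  rewrite nuE /=.
  have [ba|ab] := leP b a.
    by rewrite set_itv_ge ?bnd_simp -?leNgt// set0I /p /pushforward preimage_set0 !measure0 mule0 add0e.
  have -> : p `]a, b]%classic = ((Num.max b 0 - Num.max a 0) * c)%:E.
    rewrite /p /pushforward.
    rewrite (_ : _ @^-1` _ = cball b `\` cball a); last first.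
      apply/seteqP; split => w; rewrite /cball /= in_itv /=.
        by move=> /andP[aw wb]; split => //; apply/negP; rewrite -ltNge.
      by move=> [wb /negP]; rewrite -ltNge => ->.
    have mb : (mu2 R (cball b) < +oo)%E by rewrite measure_cball ltry.
    transitivity (mu2 R (cball b) - mu2 R (cball b `&` cball a))%E.
      exact: (measureD (measurable_cball b) (measurable_cball a) mb).
    rewrite (_ : _ `&` _ = cball a); last first.
      by apply/setIidPr => w; rewrite /cball /= => /le_trans -> //; exact: ltW.
    by rewrite (measure_cball b) (measure_cball a) -EFinB mulrBl.
  rewrite -EFinM mulrCA mulVf ?gt_eqF// mulr1.
  rewrite /neg lebesgue_measure_itv /= lte_fin ab.
  have [a0|a0] := leP 0 a.
    rewrite (_ : _ `&` _ = set0) ?measure0; last first.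
      by apply/seteqP; split => // x [] /=; rewrite !in_itv /=; lra.
    by rewrite adde0 max_l// ltW// (le_lt_trans a0).
  rewrite subr0; have [b0|b0] := leP 0 b.
    rewrite (_ : _ `&` _ = `]a, 0[%classic); last first.
      apply/seteqP; split => x /=; rewrite !in_itv /=; first by move=> [/andP[-> _] ->].
      by move=> /andP[-> x0]; split => //=; rewrite (le_trans (ltW x0)).
    by rewrite lebesgue_measure_itv /= lte_fin a0 -!EFinD; congr EFin; lra.
  rewrite add0e (_ : _ `&` _ = `]a, b]%classic); last first.
    by apply/setIidPl => x /=; rewrite !in_itv /= => /andP[_ /le_lt_trans]; apply.
  by rewrite lebesgue_measure_itv /= lte_fin ab.
have -> : (\int[lebesgue_measure]_(t in `[0%R, 1%R[) phi t = \int[m1]_(t in `[0%R, 1%R[) phi t)%E.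
  apply: eq_measure_integral => A mA A01.
  have An : A `&` neg = set0.
    apply/seteqP; split => // x [/A01]; rewrite /neg /= !in_itv /= => /andP[x0 _].
    by rewrite ltNge x0.
  by transitivity (nu A); [exact: E|rewrite nuE An measure0 adde0].
rewrite ge0_integral_mscale//.
rewrite muleA -(fineK fb) -EFinM /= divff ?gt_eqF// mul1e.
rewrite (ge0_integral_pushforward (@measurable_sqmod R))//.
by move=> t; rewrite inE /= in_itv; exact: phi0.
Qed.

(** The beta integral B(n+1, k+1). *)
Lemma beta_moment (R : realType) (n k : nat) :
  (\int[lebesgue_measure]_(t in `[0%R, 1%R[) (t ^+ n * (1 - t) ^+ k)%:E =
   (k`!%:R / (rising k.+1 n)%:R : R)%:E)%E.
Proof.
rewrite integral_itv_bndo_bndc; last first.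
  apply/measurable_EFinP; apply: measurable_funTS; apply: measurable_funM.
    exact: measurable_funX.
  by apply: measurable_funX; apply: measurable_funB.
have := @EFin_beta_fun R n.+1 k.+1; rewrite beta_fun_fact => E.
rewrite integral_mkcond; transitivity ((n`! * k`!)%:R / (n + k).+1`!%:R : R)%:E.
  rewrite E; apply: eq_integral => x _.
  rewrite /patch /=; case: ifPn => // _.
congr EFin; rewrite (_ : (n + k).+1`! = (n`! * rising k.+1 n)%N); last first.
  rewrite /rising; elim: k {E} => [|k IH].
    by rewrite big_ord1 !addn0 factS mulnC.
  rewrite addnS factS IH [in RHS]big_ord_recr /= mulnCA; congr muln.
  by rewrite mulnC; congr muln; lia.
rewrite !natrM invfM mulrACA divff ?mul1r//.
Qed.

(** * Discrete Parseval identity *)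

(** Roots of order 2^(p+2): the order is exact because the power 2^(p+1) is -1,
    and the root is not real because its order exceeds 2. *)
Lemma pow2_root (R : realType) (p : nat) : exists o : R[i],
  [/\ normc o = 1, complex.Im o != 0 & (2 ^ p.+2).-primitive_root o].
Proof.
pose o : R[i] := (2 ^ p.+1).-root (-1).
have oX : o ^+ (2 ^ p.+1) = -1 by rewrite rootCK// expn_gt0.
have o1 : o ^+ (2 ^ p.+2) = 1 by rewrite expnSr exprM oX sqrrN expr1n.
have n1 : normc o = 1.
  have : normc o ^+ (2 ^ p.+2) = 1 by rewrite -normcX o1 normc1.
  by move/eqP; rewrite pexpr_eq1 ?expn_gt0 ?normc_ge0// => /eqP.
have N11 : (-1 : R[i]) != 1.
  by rewrite -subr_eq0 -opprD oppr_eq0 -(natrD _ 1 1) pnatr_eq0.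
exists o; split => //.
- apply/eqP => o0; have := normc_sqr o; rewrite n1 o0 expr0n addr0 expr1n => Re1.
  have oR : o = (complex.Re o)%:C%C by rewrite [LHS]complexE o0 /= mulr0 addr0.
  have o2 : o ^+ 2 = 1 by rewrite oR -rmorphXn /= -Re1.
  by move: oX; rewrite expnS exprM o2 expr1n => /eqP; rewrite eq_sym (negPf N11).
- have [d od dd] := prim_order_exists (n := 2 ^ p.+2) (expn_gt0 _ _) o1.
  move: dd => /dvdn_pfactor-/(_ isT)[k]; rewrite leq_eqVlt => /orP[/eqP-> dE|kp dE].
    by rewrite -dE.
  have dv : (d %| 2 ^ p.+1)%N by rewrite dE dvdn_exp2l.
  have := oX; rewrite -(divnK dv) mulnC exprM (prim_expr_order od) expr1n.
  by move/eqP; rewrite eq_sym (negPf N11).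
Qed.

(** Orthogonality of characters of the cyclic group of order N; it requires the
    degree to stay below N, so that distinct powers of the root differ. *)
Lemma root_parseval (R : realType) (N K : nat) (o : R[i]) (c : nat -> R[i]) :
  N.-primitive_root o -> normc o = 1 -> (K <= N)%N ->
  \sum_(j < N) normc (\sum_(n < K) c n * o ^+ j ^+ n) ^+ 2 =
  N%:R * \sum_(n < K) normc (c n) ^+ 2.
Proof.
move=> po o1 KN; apply: complexI; rewrite rmorphM /= rmorph_nat !rmorph_sum /=.
have sq (z : R[i]) : (normc z ^+ 2)%:C%C = z * z^*%C by rewrite rmorphXn /= -normCE sqr_normc.
have oJ : o * o^*%C = 1 by rewrite -sq o1 expr1n.
under eq_bigr => j _ do rewrite sq rmorph_sum /= mulr_suml.
rewrite exchange_big /= mulr_sumr; apply: eq_bigr => n _.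
under eq_bigr => j _ do rewrite mulr_sumr.
rewrite exchange_big /= (bigD1 n)//= [X in _ + X]big1 ?addr0.
  under eq_bigr => j _.
    rewrite rmorphM !rmorphXn /= mulrACA -exprMn -exprMn oJ !expr1n mulr1 -sq.
    over.
  by rewrite sumr_const card_ord mulr_natl.
(* the sum over j is geometric, with ratio x <> 1 and x^N = 1 *)
move=> m mn; set x := o ^+ n * (o^*%C) ^+ m.
transitivity (\sum_(j < N) c n * (c m)^*%C * x ^+ j).
  apply: eq_bigr => j _; rewrite rmorphM !rmorphXn /= mulrACA; congr (_ * _).
  by rewrite /x exprMn -!exprM ![(_ * j)%N]mulnC.
rewrite -mulr_sumr (_ : \sum_(i < N) x ^+ i = 0) ?mulr0//.
have xN : x ^+ N = 1.
  rewrite /x exprMn exprAC (prim_expr_order po) expr1n mul1r exprAC.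
  by rewrite -rmorphXn /= (prim_expr_order po) rmorph1 expr1n.
have x1 : x - 1 != 0.
  apply: contra_neq mn => /eqP; rewrite subr_eq0 => /eqP x1.
  apply/val_inj/eqP; rewrite /= eq_sym -(modn_small (leq_trans (ltn_ord n) KN)).
  rewrite -(modn_small (leq_trans (ltn_ord m) KN)) -(eq_prim_root_expr po).
  apply/eqP; transitivity (x * o ^+ m); last by rewrite x1 mul1r.
  by rewrite /x -mulrA -exprMn [_^*%C * _]mulrC oJ expr1n mulr1.
by apply: (mulfI x1); rewrite -subrX1 xN subrr mulr0.
Qed.

(** * Functions of z on the real plane *)

Definition cplx (R : realType) (w : plane R) : R[i] := (w.1 +i* w.2)%C.

Definition plane_disc (R : realType) : set (plane R) := [set w | disc (cplx w)].
Arguments plane_disc : clear implicits.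

Lemma cplx_cmul (R : realType) (o : R[i]) (w : plane R) :
  cplx (cmul_plane o w) = o * cplx w.
Proof. by case: o => a b; congr (_ +i* _)%C; exact: addrC. Qed.

Lemma normc_cplx (R : realType) (w : plane R) : normc (cplx w) ^+ 2 = sqmod w.
Proof. by rewrite normc_sqr. Qed.

Lemma plane_discE (R : realType) : plane_disc R = @sqmod R @^-1` `[0, 1[%classic.
Proof.
apply/seteqP; split => w; rewrite /plane_disc /= in_itv /= -normc_cplx sqr_ge0 /=.
  by move=> /discE h; rewrite expr_lt1// normc_ge0.
by rewrite expr_lt1 ?normc_ge0// => h; apply/discE.
Qed.

Lemma measurable_plane_disc (R : realType) : measurable (plane_disc R).
Proof.
rewrite plane_discE -[X in measurable X]setTI; apply: measurable_sqmod => //.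
Qed.

Lemma measurable_cplxX (R : realType) n :
  measurable_fun setT (fun w : plane R => complex.Re (cplx w ^+ n)) /\
  measurable_fun setT (fun w : plane R => complex.Im (cplx w ^+ n)).
Proof.
elim: n => [|n [IH1 IH2]].
  by split; under eq_fun do rewrite expr0; exact: measurable_cst.
have ReM (w : plane R) : complex.Re (cplx w ^+ n.+1) =
    w.1 * complex.Re (cplx w ^+ n) - w.2 * complex.Im (cplx w ^+ n).
  by rewrite exprS; case: (cplx w ^+ n).
have ImM (w : plane R) : complex.Im (cplx w ^+ n.+1) =
    w.1 * complex.Im (cplx w ^+ n) + w.2 * complex.Re (cplx w ^+ n).
  by rewrite exprS; case: (cplx w ^+ n).
split; [under eq_fun do rewrite ReM|under eq_fun do rewrite ImM].
  by apply: measurable_funB; apply: measurable_funM.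
by apply: measurable_funD; apply: measurable_funM.
Qed.

Definition partial_sum (R : realType) (x : nat -> R[i]) (N : nat) (z : R[i]) : R[i] :=
  \sum_(n < N) x n * z ^+ n.

Lemma measurable_partial_sum (R : realType) (x : nat -> R[i]) N :
  measurable_fun setT (fun w : plane R => normc (partial_sum x N (cplx w)) ^+ 2).
Proof.
under eq_fun do rewrite normc_sqr /partial_sum Re_sum Im_sum.
have ReM (w : plane R) n : complex.Re (x n * cplx w ^+ n) =
    complex.Re (x n) * complex.Re (cplx w ^+ n) - complex.Im (x n) * complex.Im (cplx w ^+ n).
  by case: (x n) => a b; case: (cplx w ^+ n).
have ImM (w : plane R) n : complex.Im (x n * cplx w ^+ n) =
    complex.Re (x n) * complex.Im (cplx w ^+ n) + complex.Im (x n) * complex.Re (cplx w ^+ n).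
  by case: (x n) => a b; case: (cplx w ^+ n).
apply: measurable_funD; apply: measurable_funX; apply: measurable_sum => n.
  under eq_fun do rewrite ReM.
  have [h1 h2] := measurable_cplxX R n.
  by apply: measurable_funB; apply: measurable_funM => //; exact: measurable_cst.
under eq_fun do rewrite ImM.
have [h1 h2] := measurable_cplxX R n.
by apply: measurable_funD; apply: measurable_funM => //; exact: measurable_cst.
Qed.

Lemma normc_dist (R : realType) (a b : R[i]) : normc a - normc b <= normc (a - b).
Proof. by rewrite lerBlDr -{1}(subrK b a); exact: le_normcD. Qed.

Lemma normc_cvg (R : realType) (u : nat -> R[i]^o) (L : R[i]^o) :
  u @ \oo --> L -> (fun n => normc (u n)) @ \oo --> normc L.
Proof.
move=> /cvgrPdist_lt uL; apply/cvgrPdist_lt => e e0.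
have ec : 0 < e%:C%C :> R[i] by rewrite (ltcR 0).
have := uL _ ec; apply: filterS => n; rewrite normCE (ltcR _ e).
apply: le_lt_trans; rewrite ler_norml; apply/andP; split; last exact: normc_dist.
by rewrite lerNl opprB -[in leRHS]normcN opprB normc_dist.
Qed.

Lemma partial_sum_cvg (R : realType) (x : nat -> R[i]) (z : R[i]) : absconv x -> disc z ->
  (fun N => normc (partial_sum x N z) ^+ 2) @ \oo --> normc (power_sum x z) ^+ 2.
Proof.
move=> hx dz; have := normc_cvg (power_sum_cvg hx dz).
rewrite /series /= => h; rewrite expr2; under eq_cvg do rewrite expr2.
by apply: cvgM; under eq_cvg do rewrite /partial_sum -(big_mkord xpredT (fun n => x n * z ^+ n)).
Qed.

Lemma measurable_power_sum (R : realType) (x : nat -> R[i]) : absconv x ->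
  measurable_fun (plane_disc R) (fun w : plane R => normc (power_sum x (cplx w)) ^+ 2).
Proof.
move=> hx.
apply: (measurable_fun_cvg (h := fun N w => normc (partial_sum x N (cplx w)) ^+ 2)) => [N|w dw].
  by apply: measurable_funTS; exact: measurable_partial_sum.
exact: partial_sum_cvg.
Qed.

(** * Weighted square integral of a power series *)

Lemma limn_einf_le_cst (R : realType) (u : nat -> \bar R) (B : \bar R) :
  (forall n, (u n <= B)%E) -> (limn_einf u <= B)%E.
Proof.
move=> uB; rewrite limn_einf_lim; apply: lime_le; first exact: is_cvg_einfs.
apply: nearW => n; apply: le_trans (uB n); apply: ereal_inf_lbound.
by exists n => //=.
Qed.

(** A lower bound that converges suffices, without any convergence of the larger
    sequence. *)
Lemma cvg_le_limn_einf (R : realType) (u v : nat -> \bar R) (L : \bar R) :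
  v @ \oo --> L -> (forall n, (v n <= u n)%E) -> (L <= limn_einf u)%E.
Proof.
move=> vL vu; have [<- _] := cvg_limn_einf_sup vL.
rewrite !limn_einf_lim; apply: lee_lim; [exact: is_cvg_einfs|exact: is_cvg_einfs|].
apply: nearW => n; apply: le_ereal_inf_tmp => _ [k /= nk <-].
by apply: le_trans (vu k); apply: ereal_inf_lbound; exists k.
Qed.

Lemma cplx_iter (R : realType) (o : R[i]) j (w : plane R) :
  cplx (iter j (cmul_plane o) w) = o ^+ j * cplx w.
Proof. by elim: j => [|j IH] /=; rewrite ?mul1r// cplx_cmul IH exprS mulrA. Qed.

Lemma normc_rot (R : realType) (o z : R[i]) j :
  normc o = 1 -> normc (o ^+ j * z) = normc z.
Proof. by move=> o1; rewrite normcM normcX o1 expr1n mul1r. Qed.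

Lemma sqmod_iter (R : realType) (o : R[i]) j (w : plane R) : normc o = 1 ->
  sqmod (iter j (cmul_plane o) w) = sqmod w.
Proof. by move=> o1; rewrite -!normc_cplx cplx_iter normc_rot. Qed.

Lemma plane_disc_iter (R : realType) (o : R[i]) j (w : plane R) : normc o = 1 ->
  plane_disc R (iter j (cmul_plane o) w) = plane_disc R w.
Proof. by move=> o1; rewrite plane_discE /= sqmod_iter. Qed.

Lemma measurable_iter_cmul (R : realType) (o : R[i]) j :
  measurable_fun setT (iter j (cmul_plane o) : plane R -> plane R).
Proof.
elim: j => [|j IH] /=; first exact: measurable_id.
by apply: (measurableT_comp (measurable_cmul_plane o)).
Qed.

Lemma measurable_rotate (R : realType) (o : R[i]) j (G : plane R -> \bar R) :
  normc o = 1 -> measurable_fun (plane_disc R) G ->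
  measurable_fun (plane_disc R) (fun w => G (iter j (cmul_plane o) w)).
Proof.
move=> o1 mG.
apply: (@measurable_comp _ _ _ _ _ _ (plane_disc R)) => //.
- exact: measurable_plane_disc.
- by move=> _ [w dw <-]; rewrite plane_disc_iter.
- by apply: measurable_funTS; exact: measurable_iter_cmul.
Qed.

Lemma ge0_integral_iter_rotate (R : realType) (o : R[i]) j (G : plane R -> \bar R) :
  normc o = 1 -> complex.Im o != 0 -> measurable_fun (plane_disc R) G ->
  (forall w, plane_disc R w -> (0 <= G w)%E) ->
  (\int[mu2 R]_(w in plane_disc R) G (iter j (cmul_plane o) w) =
   \int[mu2 R]_(w in plane_disc R) G w)%E.
Proof.
move=> o1 o2 mG G0.
have mp := @measurable_plane_disc R.
elim: j => [//|j <-].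
pose H w := G (iter j (cmul_plane o) w).
have mH : measurable_fun (plane_disc R) H by exact: measurable_rotate.
rewrite integral_mkcond [RHS]integral_mkcond -/H -(@ge0_integral_rotate _ o (H \_ (plane_disc R)))//.
- apply: eq_integral => w _; rewrite /patch /H -iterSr.
  have dE := plane_disc_iter 1 w o1; congr (if _ then _ else _).
  by apply/idP/idP => /set_mem h; apply/mem_set; move: h; rewrite -dE.
- exact/(measurable_restrictT H mp).
- move=> w; rewrite /patch; case: ifPn => // /set_mem dw.
  by apply: G0; rewrite plane_disc_iter.
Qed.

(** The mean is pointwise the discrete Parseval sum when [G] comes from a polynomial;
    it keeps the integral because each rotate has the same one. *)
Lemma ge0_integral_rotation_mean (R : realType) (o : R[i]) (M : nat)
    (G : plane R -> \bar R) : (0 < M)%N ->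
  normc o = 1 -> complex.Im o != 0 -> measurable_fun (plane_disc R) G ->
  (forall w, plane_disc R w -> (0 <= G w)%E) ->
  (\int[mu2 R]_(w in plane_disc R)
     ((M%:R^-1 : R)%:E * \sum_(j < M) G (iter j (cmul_plane o) w)) =
   \int[mu2 R]_(w in plane_disc R) G w)%E.
Proof.
move=> M0 o1 o2 mG G0; have mp := @measurable_plane_disc R.
have G0' j w : plane_disc R w -> (0 <= G (iter j (cmul_plane o) w))%E.
  by move=> dw; apply: G0; rewrite plane_disc_iter.
have mG' j : measurable_fun (plane_disc R) (fun w => G (iter j (cmul_plane o) w)).
  exact: measurable_rotate.
rewrite ge0_integralZl//; last 2 first.
- by apply: emeasurable_sum => j; exact: mG'.
- by move=> w dw; apply: sume_ge0 => j _; exact: G0'.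
rewrite (@ge0_integral_sum _ _ _ _ _ mp _ (fun (j : 'I_M) w => G (iter j (cmul_plane o) w)))//.
under eq_bigr do rewrite ge0_integral_iter_rotate//.
  have sum_cst n (y : \bar R) : (0 <= y)%E -> (\sum_(i < n) y = n%:R%:E * y)%E.
    move=> y0; elim: n => [|n IH]; first by rewrite big_ord0 mul0e.
    by rewrite big_ord_recr /= IH -natr1 EFinD ge0_muleDl ?lee_fin// mul1e.
  rewrite sum_cst; last exact: integral_ge0.
  by rewrite muleA -EFinM mulVf ?mul1e// pnatr_eq0 -lt0n.
by move=> j w; exact: G0'.
Qed.

(** Up to the area of the unit disc, the integral of |z|^(2n) (1 - |z|^2)^k. *)
Definition moment (R : realType) (k n : nat) : R := k`!%:R / (rising k.+1 n)%:R.

Lemma moment_ge0 (R : realType) k n : 0 <= moment R k n.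
Proof. by rewrite divr_ge0. Qed.

Lemma integral_monomial (R : realType) (k n : nat) :
  (\int[mu2 R]_(w in plane_disc R) (sqmod w ^+ n * (1 - sqmod w) ^+ k)%:E =
   mu2 R (cball 1) * (moment R k n)%:E)%E.
Proof.
rewrite /moment -beta_moment plane_discE.
rewrite (@ge0_integral_radial _ (fun t => (t ^+ n * (1 - t) ^+ k)%:E))//.
  apply/measurable_EFinP; apply: measurable_funTS; apply: measurable_funM.
    exact: measurable_funX.
  by apply: measurable_funX; apply: measurable_funB.
by move=> t /andP[t0 t1]; rewrite lee_fin mulr_ge0// exprn_ge0// subr_ge0 ltW.
Qed.

Lemma measurable_weight (R : realType) k (f : plane R -> R) :
  measurable_fun (plane_disc R) f ->
  measurable_fun (plane_disc R) (fun w => (f w * (1 - sqmod w) ^+ k)%:E).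
Proof.
move=> mf; apply/measurable_EFinP; apply: measurable_funM => //.
apply: measurable_funTS; apply: measurable_funX; apply: measurable_funB => //.
exact: measurable_sqmod.
Qed.

Lemma weight_ge0 (R : realType) k (w : plane R) : plane_disc R w -> 0 <= (1 - sqmod w) ^+ k.
Proof.
by rewrite plane_discE /= in_itv /= => /andP[_ /ltW w1]; rewrite exprn_ge0// subr_ge0.
Qed.

Lemma integral_diagonal (R : realType) (x : nat -> R[i]) k N :
  (\int[mu2 R]_(w in plane_disc R)
     ((\sum_(n < N) normc (x n * cplx w ^+ n) ^+ 2) * (1 - sqmod w) ^+ k)%:E =
   mu2 R (cball 1) * (\sum_(n < N) normc (x n) ^+ 2 * moment R k n)%:E)%E.
Proof.
have mp := @measurable_plane_disc R.
have mm n : measurable_fun (plane_disc R) (fun w => (sqmod w ^+ n * (1 - sqmod w) ^+ k)%:E).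
  by apply: measurable_weight; apply: measurable_funTS; apply: measurable_funX; exact: measurable_sqmod.
have mm0 n w : plane_disc R w -> (0 <= (sqmod w ^+ n * (1 - sqmod w) ^+ k)%:E)%E.
  by move=> dw; rewrite lee_fin mulr_ge0 ?weight_ge0// -normc_cplx exprn_ge0// sqr_ge0.
transitivity (\int[mu2 R]_(w in plane_disc R) \sum_(n < N)
    ((normc (x n) ^+ 2)%:E * (sqmod w ^+ n * (1 - sqmod w) ^+ k)%:E))%E.
  apply: eq_integral => w _; rewrite mulr_suml -sumEFin; apply: eq_bigr => n _.
  rewrite -EFinM; congr EFin.
  by rewrite normcM normcX exprMn exprAC normc_cplx mulrA.
rewrite (@ge0_integral_sum _ _ _ _ _ mp _ (fun (n : 'I_N) w =>
  ((normc (x n) ^+ 2)%:E * (sqmod w ^+ n * (1 - sqmod w) ^+ k)%:E)%E))//; last 2 first.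
- by move=> n; apply: emeasurable_funM => //; exact: measurable_cst.
- by move=> n w dw; apply: mule_ge0; [rewrite lee_fin sqr_ge0|exact: mm0].
rewrite -sumEFin ge0_sume_distrr; last first.
  by move=> n _; rewrite lee_fin mulr_ge0 ?sqr_ge0 ?moment_ge0.
apply: eq_bigr => n _; rewrite ge0_integralZl//; last by rewrite lee_fin sqr_ge0.
  by rewrite integral_monomial EFinM muleCA.
exact: mm0.
Qed.

Lemma partial_sum_rot (R : realType) (x : nat -> R[i]) N (o z : R[i]) j :
  partial_sum x N (o ^+ j * z) = \sum_(n < N) (x n * z ^+ n) * o ^+ j ^+ n.
Proof. by apply: eq_bigr => n _; rewrite exprMn mulrCA mulrC. Qed.

(** Averaging over rotations by roots of unity of order exceeding the degree
    removes the cross terms pointwise. *)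
Lemma integral_partial_sum (R : realType) (x : nat -> R[i]) k N :
  (\int[mu2 R]_(w in plane_disc R) (normc (partial_sum x N (cplx w)) ^+ 2 * (1 - sqmod w) ^+ k)%:E =
   mu2 R (cball 1) * (\sum_(n < N) normc (x n) ^+ 2 * moment R k n)%:E)%E.
Proof.
have [rt [rt1 rt2 rtM]] := pow2_root R N.
set M := (2 ^ N.+2)%N in rtM; have M0 : (0 < M)%N by rewrite expn_gt0.
have NM : (N <= M)%N.
  by apply: leq_trans (leq_trans (leqnSn N) (leqnSn _)) (ltnW (ltn_expl _ _)).
rewrite -(@ge0_integral_rotation_mean _ rt M)//; last 2 first.
- by apply: measurable_weight; apply: measurable_funTS; exact: measurable_partial_sum.
- by move=> w dw; rewrite lee_fin mulr_ge0 ?weight_ge0 ?sqr_ge0.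
rewrite -integral_diagonal; apply: eq_integral => w _.
rewrite sumEFin -EFinM; congr EFin.
under eq_bigr do rewrite sqmod_iter// cplx_iter partial_sum_rot.
rewrite -mulr_suml (@root_parseval _ M N rt (fun n => x n * cplx w ^+ n))//.
rewrite mulrA mulKf//.
by rewrite pnatr_eq0 -lt0n.
Qed.

(** Fatou's lemma applied to the partial sums. *)
Lemma integral_power_sum_le (R : realType) (x : nat -> R[i]) k (B : R) : absconv x ->
  (forall N, \sum_(n < N) normc (x n) ^+ 2 * moment R k n <= B) ->
  (\int[mu2 R]_(w in plane_disc R) (normc (power_sum x (cplx w)) ^+ 2 * (1 - sqmod w) ^+ k)%:E <=
   mu2 R (cball 1) * B%:E)%E.
Proof.
move=> hx hB; have mp := @measurable_plane_disc R.
pose F N (w : plane R) := (normc (partial_sum x N (cplx w)) ^+ 2 * (1 - sqmod w) ^+ k)%:E.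
have mF N : measurable_fun (plane_disc R) (F N).
  by apply: measurable_weight; apply: measurable_funTS; exact: measurable_partial_sum.
have F0 N w : plane_disc R w -> (0 <= F N w)%E.
  by move=> dw; rewrite lee_fin mulr_ge0 ?weight_ge0 ?sqr_ge0.
apply: (@le_trans _ _ (limn_einf (fun N => \int[mu2 R]_(w in plane_disc R) F N w)%E)).
  rewrite (_ : (\int[mu2 R]_(w in plane_disc R) _)%E =
    (\int[mu2 R]_(w in plane_disc R) limn_einf (F^~ w))%E); first exact: fatou.
  apply: eq_integral => w /set_mem dw.
  have h : (F^~ w) @ \oo --> (normc (power_sum x (cplx w)) ^+ 2 * (1 - sqmod w) ^+ k)%:E.
    by apply: cvg_EFin; [exact: nearW|apply: cvgMr_tmp; exact: partial_sum_cvg].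
  by have [-> _] := cvg_limn_einf_sup h.
apply: limn_einf_le_cst => N; rewrite integral_partial_sum.
by apply: lee_wpmul2l => //; rewrite lee_fin.
Qed.

(** The remainder depends on the modulus of [z] only, hence it is uniform over
    the rotates of a point. *)
Lemma power_sum_partial_tail (R : realType) (x : nat -> R[i]) (r : R) :
  absconv x -> 0 <= r < 1 ->
  let a n := normc (x n) * r ^+ n in
  [/\ forall n, 0 <= a n, bounded_sums a &
      forall z p N, normc z = r -> (p <= N)%N ->
        normc (power_sum x z - partial_sum x N z) <= limn (series a) - \sum_(n < p) a n].
Proof.
move=> hx r01 a; have sa : bounded_sums a := hx r r01.
have a0 n : 0 <= a n.
  by rewrite mulr_ge0 ?normc_ge0// exprn_ge0//; case/andP: r01.
split => // z p N zr pN.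
have aE n : normc (x n * z ^+ n) = a n by rewrite normcM normcX zr.
rewrite /partial_sum -(big_mkord xpredT (fun n => x n * z ^+ n)); apply: csum_tail.
  by under eq_fun do rewrite aE.
move=> K NK; under eq_bigr do rewrite aE.
rewrite lerBrDl; apply: (@le_trans _ _ (\sum_(n < K) a n)); last exact: bounded_sums_le_lim.
rewrite -!(big_mkord xpredT) [leRHS](big_cat_nat (n := N))//= lerD2r.
by rewrite [leRHS](big_cat_nat (n := p))//= lerDl sumr_ge0.
Qed.

(** Fatou's lemma applied to the averages of |h|^2 over rotations by roots of
    unity of order N.  On the circle through a given point h is within e of its
    partial sum of degree less than N, for which the average is
    sum |h_n z^n|^2 exactly, and e tends to 0 with N. *)
Lemma integral_power_sum_ge (R : realType) (x : nat -> R[i]) k K : absconv x ->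
  (mu2 R (cball 1) * (\sum_(n < K) normc (x n) ^+ 2 * moment R k n)%:E <=
   \int[mu2 R]_(w in plane_disc R) (normc (power_sum x (cplx w)) ^+ 2 * (1 - sqmod w) ^+ k)%:E)%E.
Proof.
move=> hx; have mp := @measurable_plane_disc R.
pose F (w : plane R) := (normc (power_sum x (cplx w)) ^+ 2 * (1 - sqmod w) ^+ k)%:E.
have mF : measurable_fun (plane_disc R) F by apply: measurable_weight; exact: measurable_power_sum.
have F0 w : plane_disc R w -> (0 <= F w)%E.
  by move=> dw; rewrite lee_fin mulr_ge0 ?weight_ge0 ?sqr_ge0.
pose M p := (2 ^ (K + p).+2)%N.
have M0 p : (0 < M p)%N by rewrite expn_gt0.
have MK p : (K + p <= M p)%N.
  by apply: leq_trans (leq_trans (leqnSn _) (leqnSn _)) (ltnW (ltn_expl _ _)).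
have /choice[rt rtP] : forall p, exists om : R[i],
    [/\ normc om = 1, complex.Im om != 0 & (M p).-primitive_root om].
  by move=> p; exact: pow2_root.
pose A p (w : plane R) :=
  (((M p)%:R^-1 : R)%:E * \sum_(j < M p) F (iter j (cmul_plane (rt p)) w))%E.
have AE p : (\int[mu2 R]_(w in plane_disc R) A p w = \int[mu2 R]_(w in plane_disc R) F w)%E.
  by have [h1 h2 _] := rtP p; exact: ge0_integral_rotation_mean.
have mA p : measurable_fun (plane_disc R) (A p).
  have [h1 h2 _] := rtP p; apply: emeasurable_funM; first exact: measurable_cst.
  by apply: emeasurable_sum => j; exact: measurable_rotate.
have A0 p w : plane_disc R w -> (0 <= A p w)%E.
  move=> dw; have [h1 h2 _] := rtP p; apply: mule_ge0; first by rewrite lee_fin.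
  by apply: sume_ge0 => j _; apply: F0; rewrite plane_disc_iter.
rewrite -integral_diagonal.
apply: (@le_trans _ _ (\int[mu2 R]_(w in plane_disc R) limn_einf (A^~ w))%E); last first.
  apply: le_trans (fatou _ _ _ _) _ => //.
  by apply: limn_einf_le_cst => p; rewrite AE.
apply: ge0_le_integral => //.
- by move=> w dw; rewrite lee_fin mulr_ge0 ?weight_ge0// sumr_ge0// => n _; rewrite sqr_ge0.
- apply: measurable_weight; apply: measurable_funTS.
  apply: measurable_sum => n; under eq_fun do
    rewrite normcM normcX exprMn exprAC normc_cplx.
  apply: measurable_funM; first exact: measurable_cst.
  by apply: measurable_funX; exact: measurable_sqmod.
- rewrite /limn_einf; apply: measurableT_comp => //.
  apply: measurable_fun_limn_esup => p.
  by apply: (measurableT_comp _ (mA p)).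
move=> w dw.
have r1 : 0 <= normc (cplx w) < 1 by rewrite normc_ge0; apply/discE.
have [a0 sa tail] := power_sum_partial_tail hx r1.
set a := (fun n => _) in a0 sa tail; pose l := limn (series a).
have l0 : 0 <= l by have := bounded_sums_le_lim 0%N a0 sa; rewrite big_ord0.
pose e p := l - \sum_(n < p) a n.
have e0 p : 0 <= e p by rewrite subr_ge0; exact: bounded_sums_le_lim.
have ecvg : e @ \oo --> (0 : R).
  rewrite -(subrr l); apply: cvgB; first exact: cvg_cst.
  under eq_cvg do rewrite -(big_mkord xpredT); exact: bounded_sums_cvg.
pose S := \sum_(n < K) normc (x n * cplx w ^+ n) ^+ 2.
pose W := (1 - sqmod w) ^+ k; have W0 : 0 <= W by exact: weight_ge0.
have vcvg : (fun p => ((S - 2 * l * e p) * W)%:E) @ \oo --> (S * W)%:E.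
  apply: cvg_EFin; first exact: nearW.
  have -> : S * W = (S - 2 * l * 0) * W by rewrite mulr0 subr0.
  by apply: cvgMr_tmp; apply: cvgB; [exact: cvg_cst|apply: cvgMl_tmp].
apply: (cvg_le_limn_einf vcvg) => p; have [h1 h2 h3] := rtP p.
rewrite /A /F sumEFin -EFinM lee_fin.
under eq_bigr do rewrite sqmod_iter// cplx_iter.
rewrite -mulr_suml mulrA ler_wpM2r// [leRHS]mulrC ler_pdivlMr ?ltr0n//.
(* if u >= v - t then u^2 >= v^2 - 2 v t, and v is at most l *)
have key j : normc (partial_sum x (M p) (rt p ^+ j * cplx w)) ^+ 2 - 2 * l * e p <=
    normc (power_sum x (rt p ^+ j * cplx w)) ^+ 2.
  set z := _ * _; have zr : normc z = normc (cplx w) by rewrite /z normc_rot.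
  have d := tail z p (M p) zr (leq_trans (leq_addl _ _) (MK p)); rewrite -/l -/(e p) in d.
  have b : normc (partial_sum x (M p) z) <= l.
    apply: le_trans (normc_sum _ _ _) _; apply: le_trans (bounded_sums_le_lim (M p) a0 sa).
    by apply: ler_sum => n _; rewrite normcM normcX zr.
  have c : normc (partial_sum x (M p) z) - normc (power_sum x z) <= e p.
    by apply: le_trans (normc_dist _ _) _; rewrite -normcN opprB.
  have := normc_ge0 (partial_sum x (M p) z); have := normc_ge0 (power_sum x z); have := e0 p.
  move: b c; move: (normc (partial_sum _ _ _)) (normc (power_sum _ _)) (e p) => u v t b c t0 v0 u0.
  have [tu|ut] := leP t u; nra.
apply: (@le_trans _ _ (\sum_(j < M p)
    (normc (partial_sum x (M p) (rt p ^+ j * cplx w)) ^+ 2 - 2 * l * e p))); last first.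
  by apply: ler_sum => j _; exact: key.
have -> (f : 'I_(M p) -> R) (c : R) : \sum_(j < M p) (f j - c) = \sum_(j < M p) f j - c * (M p)%:R.
  by rewrite sumrB sumr_const card_ord mulr_natr.
rewrite mulrBl lerD2r mulrC.
under eq_bigr do rewrite partial_sum_rot.
rewrite (@root_parseval _ (M p) (M p) (rt p) (fun n => x n * cplx w ^+ n))//.
rewrite ler_wpM2l// -(subnKC (leq_trans (leq_addr _ _) (MK p))).
by rewrite big_split_ord /= lerDl sumr_ge0// => n _; rewrite sqr_ge0.
Qed.

(** * The local Dirichlet space *)

Lemma power_sum_finite (R : realType) (c : nat -> R[i]) m (z : R[i]) :
  (forall n, (m <= n)%N -> c n = 0) ->
  absconv c /\ (disc z -> power_sum c z = \sum_(n < m) c n * z ^+ n).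
Proof.
move=> c0; have hc : absconv c.
  apply: (@absconv_bounded _ _ (\sum_(n < m) normc (c n))) => n.
  have [nm|mn] := ltnP n m.
    by rewrite (bigD1 (Ordinal nm))//= lerDl sumr_ge0// => i _; exact: normc_ge0.
  by rewrite c0// normc0 sumr_ge0// => i _; exact: normc_ge0.
split=> // dz; apply/eqP; rewrite -subr_eq0; apply/eqP/eq0_normc/eqP.
rewrite eq_le normc_ge0 andbT -(big_mkord xpredT (fun n => c n * z ^+ n)).
apply: csum_tail; first exact: power_sum_bounded_sums.
move=> N mN; rewrite big_nat_cond big1// => n /andP[/andP[mn _] _].
by rewrite c0// mul0r normc0.
Qed.

(** In particular the kernel of the m-th derivative consists of the polynomials of
    degree less than [m]. *)
Lemma iter_coef_derivE (R : realType) m (x : nat -> R[i]) n :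
  iter m (@coef_deriv R) x n = (rising m n)%:R * x (n + m)%N.
Proof.
elim: m n => [|m IH] n /=; first by rewrite /rising big_ord0 mul1r addn0.
rewrite /coef_deriv IH mulrA -natrM risingS addSnnS; congr (_%:R * _).
by rewrite /rising big_ord_recr /= mulnC addnS addSn.
Qed.

Lemma power_sum_iter_mulXsub (R : realType) (l : R[i]) m s (x : nat -> R[i]) (z : R[i]) :
  wl2 s x ->
  wl2 s (iter m (mulXsub l) x) /\
  (disc z -> power_sum (iter m (mulXsub l) x) z = (z - l) ^+ m * power_sum x z).
Proof.
move=> hx; elim: m => [|m [IH1 IH2]] /=; first by split => // _; rewrite mul1r.
have h := wl2_mulXsub l IH1; split => // dz.
by rewrite power_sum_mulXsub ?IH2 ?exprS ?mulrA//; [exact: wl2_absconv IH1|exact: wl2_absconv h].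
Qed.

(** B(n+1, 2m) is comparable to (n+1)^(-2m). *)
Lemma wl2_moment (R : realType) m (h : nat -> R[i]) : (0 < m)%N ->
  wl2 m h <-> exists C : R, forall N,
    \sum_(n < N) normc (h n) ^+ 2 * moment R (2 * m - 1) n <= C.
Proof.
move=> m0; have uE n : (normc (h n) / n.+1%:R ^+ m) ^+ 2 = normc (h n) ^+ 2 / n.+1%:R ^+ (m * 2).
  by rewrite expr_div_n exprM.
pose k := (2 * m - 1)%N; have kE' : (k.+1 = m * 2)%N by rewrite /k; lia.
have r0 n : 0 < (rising k.+1 n)%:R :> R by rewrite ltr0n rising_gt0.
have n0 n : 0 < n.+1%:R ^+ k.+1 :> R by rewrite exprn_gt0.
have rge n : n.+1%:R ^+ k.+1 <= (rising k.+1 n)%:R :> R by rewrite -natrX ler_nat rising_ge.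
have rle n : (rising k.+1 n)%:R <= (k.+1)`!%:R * n.+1%:R ^+ k.+1 :> R.
  by rewrite -natrX -natrM ler_nat rising_le.
have f0 j : 0 < j`!%:R :> R by rewrite ltr0n fact_gt0.
have upper n : moment R k n <= k`!%:R * n.+1%:R ^- k.+1.
  by rewrite /moment ler_wpM2l// lef_pV2 ?posrE.
have lower n : n.+1%:R ^- k.+1 <= (k.+1)`!%:R / k`!%:R * moment R k n.
  rewrite /moment mulrA divfK ?gt_eqF// ler_pdivlMr// ler_pdivrMl// mulrC.
  exact: rle.
rewrite -/k /wl2 /l2; split => -[C hC].
  exists (k`!%:R * C) => N; apply: le_trans (ler_wpM2l (ltW (f0 k)) (hC N)).
  rewrite mulr_sumr; apply: ler_sum => n _; rewrite uE -kE' [leRHS]mulrCA.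
  by apply: ler_wpM2l (upper n); exact: sqr_ge0.
exists ((k.+1)`!%:R / k`!%:R * C) => N.
have c0 : 0 <= (k.+1)`!%:R / k`!%:R :> R by rewrite divr_ge0.
apply: le_trans (ler_wpM2l c0 (hC N)).
rewrite mulr_sumr; apply: ler_sum => n _; rewrite uE -kE' [leRHS]mulrCA.
by apply: ler_wpM2l (lower n); exact: sqr_ge0.
Qed.

Lemma dirichlet_integralP (R : realType) (m : nat) (l : R[i])
    (f : R[i]^o -> R[i]^o) (h : nat -> R[i]) : (0 < m)%N -> absconv h ->
  (forall z, disc z -> f^`(m)%classic z / (z - l) ^+ m = power_sum h z) ->
  ((dirichlet_integral m l f < +oo)%E <-> wl2 m h).
Proof.
move=> m0 hh fh; have mp := @measurable_plane_disc R.
pose k := (2 * m - 1)%N.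
have -> : dirichlet_integral m l f =
    ((pi : R)^-1%:E * \int[mu2 R]_(w in plane_disc R)
       (normc (power_sum h (cplx w)) ^+ 2 * (1 - sqmod w) ^+ k)%:E)%E.
  rewrite -(@ge0_integral_mscale _ _ _ _ _ mp (NngNum (invpi_ge0 R)))//; last 2 first.
  - by apply: measurable_weight; exact: measurable_power_sum.
  - by move=> w dw; rewrite lee_fin mulr_ge0 ?weight_ge0 ?sqr_ge0.
  by apply: eq_integral => w /set_mem dw; rewrite /= fh// normc_cplx.
have c0 := @cball1_gt0 R; have cfin := @cball1_fin R.
have fb : mu2 R (cball 1) \is a fin_num by rewrite ge0_fin_numE.
have p0 : 0 < (pi : R)^-1 by rewrite invr_gt0 pi_gt0.
rewrite (wl2_moment h m0) -/k; split => [fin|[C hC]].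
  set I := (\int[mu2 R]_(w in _) _)%E in fin.
  have I0 : (0 <= I)%E.
    by apply: integral_ge0 => w dw; rewrite lee_fin mulr_ge0 ?weight_ge0 ?sqr_ge0.
  have Ifin : I \is a fin_num.
    rewrite ge0_fin_numE// ltey; apply/eqP => Ioo.
    by move: fin; rewrite Ioo gt0_muley// lte_fin.
  exists ((fine (mu2 R (cball 1)))^-1 * fine I) => N.
  have H := integral_power_sum_ge k N hh.
  rewrite -/I -(fineK fb) -(fineK Ifin) -EFinM lee_fin in H.
  by rewrite ler_pdivlMl// fine_gt0// c0.
apply: (@le_lt_trans _ _ ((pi : R)^-1%:E * (mu2 R (cball 1) * C%:E))%E).
  by apply: lee_wpmul2l; [rewrite lee_fin ltW|exact: integral_power_sum_le].
by rewrite -(fineK fb) -!EFinM ltry.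
Qed.

Lemma wl2_0E (R : realType) (a : nat -> R[i]) :
  wl2 0 a <-> (\sum_(0 <= n <oo) (normc (a n) ^+ 2)%:E < +oo)%E.
Proof.
have a0 n : (0 <= (normc (a n) ^+ 2)%:E)%E by rewrite lee_fin sqr_ge0.
have E N : (\sum_(0 <= n < N) (normc (a n) ^+ 2)%:E =
    (\sum_(n < N) (normc (a n) / n.+1%:R ^+ 0) ^+ 2)%:E)%E.
  by rewrite -sumEFin big_mkord; apply: eq_bigr => n _; rewrite expr0 divr1.
split => [[C hC]|fin].
  apply: (@le_lt_trans _ _ C%:E); last exact: ltry.
  apply: lime_le; first by apply: is_cvg_nneseries => n _ _; exact: a0.
  by apply: nearW => N; rewrite E lee_fin.
exists (fine (\sum_(0 <= n <oo) (normc (a n) ^+ 2)%:E)%E) => N.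
rewrite -lee_fin fineK; last by rewrite ge0_fin_numE// nneseries_ge0.
by rewrite -E; apply: nneseries_lim_ge => *; exact: a0.
Qed.

(** Holomorphy is automatic for a square-summable power series. *)
Lemma hardy2P (R : realType) (f : R[i]^o -> R[i]^o) :
  hardy2 f <-> exists2 a, wl2 0 a & forall z, disc z -> f z = power_sum a z.
Proof.
split => [[_ [a [fa /wl2_0E ha]]]|[a ha fa]].
  exists a => // z dz; apply: power_sum_eq => //; last exact: fa.
  exact: wl2_absconv ha.
have hc := wl2_absconv ha; split; first exact: power_sum_derivable hc fa.
exists a; split; last exact/wl2_0E.
by move=> z dz; rewrite fa//; exact: power_sum_cvg.
Qed.

Lemma iter_twist_onto (R : realType) (l : R[i]) m k (x : nat -> R[i]) :
  normc l = 1 -> (k <= m)%N -> wl2 k x ->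
  exists2 y, wl2 0 y & iter k (twist l m) y = x.
Proof.
move=> l1; elim: k x => [|k IH] x km hx; first by exists x.
have [x' hx' <-] := twist_onto l1 km hx.
by have [y hy <-] := IH x' (ltnW km) hx'; exists y.
Qed.

Lemma wl2_iter_coef_deriv (R : realType) s k (x : nat -> R[i]) :
  wl2 s x -> wl2 (s + k) (iter k (@coef_deriv R) x).
Proof. by move=> hx; elim: k => [|k IH]; rewrite ?addn0 ?addnS //=; exact: wl2_coef_deriv. Qed.

Lemma wl2_iter_twist (R : realType) s k m (l : R[i]) (x : nat -> R[i]) :
  normc l = 1 -> wl2 s x -> wl2 (s + k) (iter k (twist l m) x).
Proof.
by move=> l1 hx; elim: k => [|k IH]; rewrite ?addn0 ?addnS //=; exact: wl2_twist.
Qed.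

Lemma wl2_iter_divXsub (R : realType) s k (l : R[i]) (x : nat -> R[i]) :
  normc l = 1 -> wl2 s x -> wl2 (s + k) (iter k (divXsub l) x).
Proof.
by move=> l1 hx; elim: k => [|k IH]; rewrite ?addn0 ?addnS //=; exact: wl2_divXsub.
Qed.

Theorem theorem1 (R : realType) (m : nat) (lambda : R[i])
    (f : R[i]^o -> R[i]^o) :
  (0 < m)%N -> torus lambda -> hardy2 f ->
  (local_dirichlet m lambda f <-> (dirichlet_integral m lambda f < +oo)%E).
Proof.
move=> m0 tl hf; set l := lambda in tl *.
have l1 : normc l = 1 by apply: complexI; exact: tl.
have l0 : l != 0.
  by apply/eqP => l0; move: l1; rewrite l0 normc0 => /eqP; rewrite eq_sym oner_eq0.
have zl z : disc z -> (z - l) ^+ m != 0.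
  move=> /discE z1; rewrite expf_neq0// subr_eq0; apply: contraTneq z1 => ->.
  by rewrite l1 ltxx.
split.
  move=> [_ [p [g [sp /hardy2P[b hb gb] fE]]]].
  (* f^(m) / (z - l)^m has coefficients h = E^m b *)
  pose c n := p`_n; pose h := iter m (twist l m) b.
  have c0 n : (m <= n)%N -> c n = 0 by move=> mn; apply: nth_default; exact: leq_trans mn.
  have [hc _] := power_sum_finite 0 c0.
  have hh : wl2 m h.
    exact: (wl2_iter_twist m m l1 hb).
  have [hM _] := power_sum_iter_mulXsub l m 0 hb.
  have fPS z : disc z -> f z = power_sum (c + iter m (mulXsub l) b) z.
    move=> dz; rewrite fE// gb//.
    have [hM' /(_ dz) E] := power_sum_iter_mulXsub l m z hb.
    have [_ /(_ dz) Ec] := power_sum_finite z c0.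
    rewrite power_sumD ?E ?Ec//; last exact: wl2_absconv hM.
    congr (_ + _); rewrite horner_coef (big_ord_widen m (fun i => p`_i * z ^+ i) sp).
    rewrite big_mkcond /=; apply: eq_bigr => i _; case: ltnP => // si.
    by rewrite /c nth_default// mul0r.
  apply/(dirichlet_integralP m0 (wl2_absconv hh) _) => // z dz.
  rewrite (power_sum_derive1n m _ fPS)//; last by apply: absconvD => //; exact: wl2_absconv hM.
  rewrite iter_coef_derivD iter_coef_deriv_mulXsub//.
  have -> : iter m (@coef_deriv R) c = 0.
    by apply/funext => n; rewrite iter_coef_derivE c0 ?mulr0// leq_addl.
  rewrite add0r -/h; have [_ ->//] := power_sum_iter_mulXsub l m z hh.
  by rewrite mulrAC mulfV ?mul1r// zl.
move=> fin; split; first by case: hf.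
have /hardy2P[a ha fa] := hf.
pose h := iter m (divXsub l) (iter m (@coef_deriv R) a).
have hd := wl2_iter_coef_deriv m ha; rewrite add0n in hd.
have hMh k : iter k (mulXsub l) (iter k (divXsub l) (iter m (@coef_deriv R) a)) =
    iter m (@coef_deriv R) a.
  by elim: k => //= k IH; rewrite -iterS iterSr divXsubK.
have hh : wl2 (m + m) h.
  exact: wl2_iter_divXsub.
have wh : wl2 m h.
  apply/(dirichlet_integralP m0 (wl2_absconv hh) _); last exact: fin.
  move=> z dz; rewrite (power_sum_derive1n m (wl2_absconv ha) fa)// -(hMh m).
  have [_ ->//] := power_sum_iter_mulXsub l m z hh.
  by rewrite mulrAC mulfV ?mul1r// zl.
have [y hy yh] := iter_twist_onto l1 (leqnn m) wh.
(* D^m (M^m y) = M^m E^m y = M^m h = D^m a, so c has degree less than m *)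
pose c n := a n - iter m (mulXsub l) y n.
have c0 n : (m <= n)%N -> c n = 0.
  move=> mn; have : iter m (@coef_deriv R) (iter m (mulXsub l) y) = iter m (@coef_deriv R) a.
    by rewrite iter_coef_deriv_mulXsub// yh hMh.
  move=> /(congr1 (fun u => u (n - m)%N)); rewrite !iter_coef_derivE subnK//.
  have r0 : (rising m (n - m))%:R != 0 :> R[i] by rewrite pnatr_eq0 -lt0n rising_gt0.
  by move=> /(mulfI r0) E; rewrite /c E subrr.
exists (\poly_(i < m) c i), (power_sum y); split; first exact: size_poly.
  by apply/hardy2P; exists y.
move=> z dz; have [hM /(_ dz) E] := power_sum_iter_mulXsub l m z hy.
have [hc /(_ dz) Ec] := power_sum_finite z c0.
rewrite horner_poly -Ec -E -power_sumD//; last exact: wl2_absconv hM.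
rewrite fa//.
have -> // : c + iter m (mulXsub l) y = a.
by apply/funext => n; rewrite addrfctE /c subrK.
Qed.
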